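(* Let $P$ be a reduced knot projection. Then $i(P)=2$ if and only if there is a simple closed curve $C\subset S^2$ admissible for $P$ such that one of the following holds. (i) $C\cap P=\{a,b\}$ for two distinct double points $a,b$ of $P$ that are met in the cyclic order $a,b,b,a$ along $P$. (ii) $C\cap P=\{a,b,x\}$ for three distinct double points $a,b,x$ of $P$ that are met in the cyclic order $a,b,x,a,b,x$ along $P$.
   Context: A knot projection is the image of a generic immersion of an unoriented circle into the sphere $S^2$ (the only singularities are transverse double points); every knot projection is assumed to have at least one double point. Traversing $P$ once, each double point is met exactly twice; ''cyclic order along $P$'' refers to the cyclic word obtained this way (up to rotation and reversal), ignoring passages through double points not named. A double point $c$ of $P$ is nugatory if there is a simple closed curve in $S^2$ meeting $P$ only at $c$ and transverse there to both branches of $P$. A knot projection is reducible if it has a nugatory double point, and reduced otherwise. A splice at a double point removes a small neighbourhood of the double point and reconnects the four ends in one of the two planar ways without a crossing. Orient $P$ arbitrarily: the splice compatible with the orientation is the Seifert splice (applied alone it produces two closed curves); the other is the non-Seifert splice. This does not depend on the orientation chosen. The reductivity $i(P)$ is the minimum number of Seifert splices, applied simultaneously at distinct double points of $P$ (all Seifert with respect to $P$), needed to obtain a reducible knot projection (in particular a single closed curve) from $P$; $i(P)=0$ if $P$ is reducible. A simple closed curve $C\subset S^2$ is called admissible for $P$ if $C$ meets $P$ only at double points of $P$ and at each of these points $C$ is transverse to both branches of $P$ (so that on each side of $C$ there are exactly two of the four edge-ends at that double point). *)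

(* Defs.v *)
From mathcomp Require Import all_boot.

Set Implicit Arguments.
Unset Strict Implicit.
Unset Printing Implicit Defensive.

(** A closed curve drawn on the oriented sphere is given by the combinatorial
    map of a cell decomposition of S^2 whose 1-skeleton is the curve.  A dart is
    an oriented edge, identified with the edge-end at its origin; [edge]
    reverses darts and [node] rotates counterclockwise around the origin.
    The orbits of [node] of length 4 are the double points; those of length 2
    are auxiliary subdivision points of the curve, where nothing happens.
    Allowing them lets a splice turn one 4-valent point into two 2-valent ones
    without changing the darts or the edges. *)

Record diagram (D : Type) := Diagram { edge : D -> D; node : D -> D }.

Section Diagrams.

Variables (D : finType) (P : diagram D).

(** [face P x] is the dart following [x] on the boundary of the face lying to
    the left of [x]; that boundary is the [face P]-orbit of [x]. *)
Definition face (x : D) : D := finv (node P) (edge P x).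

Definition crosses (x : D) : bool := order (node P) x == 4.

Definition vertex (x : D) : {set D} := [set y | fconnect (node P) x y].

Definition double_points : {set {set D}} := [set vertex x | x : D & crosses x].

(** The other edge-end of the branch of the curve on which [x] lies. *)
Definition opposite (x : D) : D :=
  if crosses x then node P (node P x) else node P x.

(** One step of the traversal: run along [x], go straight through its endpoint,
    and return the dart along which the curve leaves.  The two traversals of the
    curve, one per orientation, are exchanged by [edge P]. *)
Definition travel (x : D) : D := opposite (edge P x).

Definition single_curve : Prop :=
  forall x y : D, fconnect travel x y || fconnect travel x (edge P y).

(** Euler's formula for a connected map: V + F = E + 2. *)
Definition spherical : Prop :=
  fcard (node P) D + fcard face D = fcard (edge P) D + 2.

Definition knot_projection : Prop :=
  [/\ involutive (edge P) /\ (forall x, edge P x != x),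
      injective (node P) /\ (forall x, order (node P) x \in [:: 2; 4]),
      single_curve,
      spherical
    & double_points != set0].

(** The cyclic word [w] of double points is read along the curve, passages
    through points not in [w] being ignored.  As the starting dart is arbitrary,
    rotations and reversal of the word are accounted for. *)
Definition met_in_cyclic_order (w : seq {set D}) : Prop :=
  exists x : D, [seq v <- [seq vertex y | y <- orbit travel x] | v \in w] = w.

(** ** Simple closed curves meeting the diagram only at double points

    The dart [x] also denotes the corner (angular sector) between [x] and
    [node P x], which lies in the face to the left of [x].  A closed curve
    transverse to both branches at each of the points where it meets the diagram
    enters such a point by some corner [x] and leaves it by the opposite corner
    [node P (node P x)]; it is recorded, up to isotopy preserving the diagram, by
    the cyclic sequence of the corners by which it enters the successive double
    points. *)

(** Faces are discs, so one can always join two corners of the same face. *)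
Definition joined (x y : D) : bool := fconnect face (node P (node P x)) y.

(** In a common face, the arcs from corner [p] to corner [q] and from [r] to [s]
    can be drawn disjointly iff the pairs {p, q} and {r, s} are not linked in
    the cyclic order of the corners of that face. *)
Definition disjoint_arcs (p q r s : D) : bool :=
  fconnect face p r ==>
    ((findex face p r < findex face p q) == (findex face p s < findex face p q)).

(** [next C x] is the successor of [x] in the cyclic sequence [C], so that the
    arcs of the curve go from corner [node P (node P x)] to corner [next C x]. *)
Definition admissible (C : seq D) : Prop :=
  [/\ all crosses C,
      uniq [seq vertex x | x <- C],
      cycle joined C
    & {in C &, forall x y, x != y ->
        disjoint_arcs (node P (node P x)) (next C x)
                      (node P (node P y)) (next C y)}].

Definition meeting_points (C : seq D) : {set {set D}} :=
  [set vertex x | x in C].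

Definition nugatory (c : {set D}) : Prop :=
  exists C : seq D, admissible C /\ meeting_points C = [set c].

Definition reducible : Prop :=
  exists c : {set D}, c \in double_points /\ nugatory c.

Definition reduced : Prop := ~ reducible.

(** ** Seifert splices

    Orient the curve so that it leaves its origin along [x].  The splices at that
    point join [x] to one of its two neighbours [node P x] and
    [finv (node P) x]; exactly one of these is also leaving, i.e. is in the
    traversal of [x], and the splice compatible with the orientation joins [x]
    to the other one, which is arriving.  Reversing the orientation exchanges
    leaving and arriving darts and gives the same pairs. *)
Definition seifert_partner (x : D) : D :=
  if fconnect travel x (node P x) then finv (node P) x else node P x.

(** Simultaneous Seifert splices, with respect to [P], at all the points of
    [S]. *)
Definition seifert_splice (S : {set {set D}}) : diagram D :=
  Diagram (edge P)
    (fun x => if vertex x \in S then seifert_partner x else node P x).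

End Diagrams.

Section Reductivity.

Variables (D : finType) (P : diagram D).

Definition made_reducible_by (k : nat) : Prop :=
  exists S : {set {set D}},
    [/\ S \subset double_points P, #|S| = k,
        knot_projection (seifert_splice P S)
      & reducible (seifert_splice P S)].

(** [k] is the reductivity i(P): the least number of splices needed. *)
Definition has_reductivity (k : nat) : Prop :=
  made_reducible_by k /\ (forall j, made_reducible_by j -> k <= j).

End Reductivity.

(* Main.v *)
Require Import Defs.
From mathcomp Require Import fingroup perm zify.
From mathcomp Require Import all_boot.

Set Implicit Arguments.
Unset Strict Implicit.
Unset Printing Implicit Defensive.

(** Cut the sphere along an admissible curve C.  Each passage of P through a
    point of C leads from one side of C to the other, so the passages through the
    points of C lie alternately on the two sides.  Orient P.  At a double point a
    curve can go through the corner between the two departing branches and the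
    opposite corner between the two arriving ones (such corners are called
    coherent below), or through the two mixed corners.  It takes the coherent
    corners exactly when the two departures lie on different sides of C.  A
    Seifert splice reconnects the branches so that precisely the coherent corners
    become joined: a curve using them avoids the spliced diagram there.

    From a curve to a splice.  In the words abba and abxabx, alternation puts the
    two departures from a, and from b, on different sides, so that a and b are
    crossed coherently.  In the second case, splice at a and b, which are
    interlaced: the result is a single curve, and C now meets it only at x.  In
    the first case, splice at a and at any point q interlaced with a: C now meets
    the result only at b.  Such a q exists ([exists_interlaced]), because
    otherwise the loop of P based at a meets the rest of P only at a, which makes
    a nugatory.

    From a splice to a curve.  A single Seifert splice disconnects P, so for
    reduced P the reductivity is 2 as soon as two splices, at p and q say, give a
    reducible projection Q.  Let c be a nugatory point of Q; a curve through c
    alone divides Q.  Seen in P, its sides are separated at c and, possibly, at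
    coherent corners of p and q.  Around every face as many separating corners
    lead from the first side to the second as back ([face_balance]), so these
    corners can be joined in P into closed curves; as P is reduced and there are
    at most three points, a single curve C results, through c and one or both of
    p and q.  Alternation leaves only the word abba for two points.  For three
    points, p cannot be met twice in succession, nor can q, since the loop in
    between would be a component of Q; with alternation only abxabx is left.

    The topology enters through the inequality V + F <= E + 2k for a map with k
    components ([genus_ge0], [euler_le]).  Cutting the map open at two opposite
    corners of a double point adds a vertex, and merges two faces or splits one.
    Cutting at all the points of a closed curve ends with a split, hence violates
    the inequality with k = 1: this is the Jordan curve theorem ([jordan]).
    Conversely a connected splice must have merged faces only, hence is spherical
    ([connected_splice]). *)

(** * Cycle counts of permutations and the genus inequality *)

Section Cycles.

Local Open Scope group_scope.

Variable T : finType.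
Implicit Types (f g : T -> T) (s t : {perm T}).

Lemma porbit_fconnect s x y : (y \in porbit s x) = fconnect s x y.
Proof.
apply/porbitP/idP => [[i ->]|/iter_findex <-]; last by eexists; rewrite permX.
by rewrite permX fconnect_iter.
Qed.

Lemma fcard_porbits f s : s =1 f -> fcard f T = #|porbits s|.
Proof.
move=> sf; rewrite -(eq_fcard sf); have symf := fconnect_sym (@perm_inj _ s).
have -> : porbits s = [set porbit s x | x in froots s].
  apply/setP=> A; apply/imsetP/imsetP => [[x _ ->]|[x _ ->]]; last by exists x.
  exists (froot s x); first exact: (roots_root symf).
  by apply/eqP; rewrite eq_porbit_mem porbit_fconnect symf connect_root.
rewrite card_in_imset => [|x y rx ry /eqP]; last first.
  rewrite eq_porbit_mem porbit_fconnect => /(rootP symf).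
  by rewrite (eqP rx) (eqP ry) => ->.
by apply: eq_card => x; rewrite !inE andbT.
Qed.

Lemma porbits_tperm_mulr s x y :
  #|porbits (s * tperm x y)| + (x \notin porbit s y).*2
    = #|porbits s| + (x != y).
Proof.
have := porbits_mul_tperm s^-1 x y; rewrite /= porbitV porbitsV => <-.
by rewrite -(porbitsV (s * _)) invMg tpermV.
Qed.

(** The map with [s] and [t] as vertex and face permutations has one component
    for each value of [g], and the inequality says that its genus is nonnegative.
    It is an equality when [s] is the identity; in general, write [s] as a
    product of transpositions, one at a time.  A transposition changes the number
    of cycles of [s * t] by one, and it can merge two components only if it merges
    two cycles of [s * t]. *)
Lemma genus_ge0 s t : exists g : T -> {set T},
  [/\ forall z, g (s z) = g z, forall z, g (t z) = g z
    & #|porbits s| + #|porbits t| + #|porbits (s * t)|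
        <= #|T| + #|g @: T|.*2].
Proof.
move: {2}_.+1 (ltnSn #|[set x | s x != x]|) => n.
elim: n => // n IHn in s *; rewrite ltnS => le_n.
have [x sx|s1] := pickP [pred x | s x != x]; last first.
  have {}s1 : s = 1 by apply/perm.permP => z; rewrite perm1; apply/eqP/negPn/negbT/s1.
  exists (porbit t); split=> [z|z|]; first by rewrite s1 perm1.
    exact: (porbit_perm t 1).
  rewrite s1 mul1g -addnn addnA !leq_add2r; exact: leq_imset_card.
rewrite /= in sx.
(* [s'] fixes [x] and everything that [s] fixes. *)
pose y := s^-1 x; pose u : {perm T} := tperm x y; pose s' : {perm T} := u * s.
have xy : x != y by apply: contraNneq sx => xy; rewrite {1}xy permKV.
have s'x : s' x = x by rewrite /s' permM tpermL permKV.
have [|g [gs' gt le_g]] := IHn s'.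
  apply: leq_trans le_n; apply: proper_card; apply/properP; split.
    apply/subsetP => z; rewrite !inE; apply: contraNneq => sz.
    rewrite /s' permM tpermD ?sz //; apply: contraNneq sx; first by move->; apply/eqP.
    by rewrite /y => yz; rewrite -{1}(permKV s x) yz sz -yz permKV.
  by exists x; rewrite !inE ?s'x ?eqxx.
have sE : s = u * s' by rewrite /s' mulgA tperm2 mul1g.
pose c (r : {perm T}) := #|porbits r|.
have Es : c s + (x \notin porbit s' y).*2 = c s' + 1.
  by rewrite sE /c porbits_mul_tperm xy.
have Est : c (s * t) + (x \notin porbit (s' * t) y).*2 = c (s' * t) + 1.
  by rewrite sE -mulgA /c porbits_mul_tperm xy.
rewrite -/(c s') -/(c t) -/(c (s' * t)) in le_g.
rewrite -/(c s) -/(c t) -/(c (s * t)); clearbody c.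
have {}Es : c s + 1 = c s'.
  have xNy : x \notin porbit s' y.
    rewrite porbit_sym porbit_fconnect fconnect_eqVf s'x.
    rewrite (@fconnect_cycle _ _ [:: x]) /= ?s'x ?inE ?eqxx //.
    by rewrite (negPf xy) eq_sym (negPf xy).
  by rewrite xNy /= in Es; lia.
have gu (h : T -> {set T}) : h x = h y ->
    (forall z, h (s' z) = h z) -> forall z, h (s z) = h z.
  move=> hxy hs' z; rewrite sE permM hs' /u.
  by case: tpermP => [->|->|].
have [gxy|gxy] := eqVneq (g x) (g y).
  exists g; split=> //; first exact: gu.
  move: Es Est le_g; case: (x \notin _).
    move: (c s) (c s') (c t) (c (s * t)) (c (s' * t)) #|T| #|g @: T|; lia.
  move: (c s) (c s') (c t) (c (s * t)) (c (s' * t)) #|T| #|g @: T|; lia.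
have gst z : g ((s' * t) z) = g z by rewrite permM gt gs'.
have xNy : x \notin porbit (s' * t) y.
  apply: contra gxy; rewrite porbit_fconnect => /iter_findex <-; apply/eqP.
  by elim: findex => //= k IHk; rewrite -{}IHk; apply: gst.
rewrite xNy /= in Est.
(* [u] merges the components of [x] and [y]. *)
pose g' z := if g z == g y then g x else g z.
exists g'; split=> [|z|]; last 1 first.
- have: #|g @: T| <= #|g y |: g' @: T|.
    apply/subset_leq_card/subsetP => _ /imsetP [z _ ->]; rewrite !inE.
    case: (eqVneq (g z)) => //= gzy; apply/imsetP; exists z => //.
    by rewrite /g' (negPf gzy).
  have := leq_b1 (g y \notin g' @: T); rewrite cardsU1 => le1 le2.
  move: Es Est le_g (leq_trans le2 (leq_add le1 (leqnn _))).
  move: (c s) (c s') (c t) (c (s * t)) (c (s' * t)) #|T|.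
  by move: #|g @: T| #|g' @: T|; lia.
- by apply: gu => [|z]; rewrite /g' ?eqxx ?(negPf gxy) // gs'.
by rewrite /g' gt.
Qed.

Section Transposition.

Variables (f f1 : T -> T) (u v : T).
Hypotheses (injf : injective f) (uv : u != v).

Lemma fcard_tperm_comp : f1 =1 tperm u v \o f ->
  fcard f1 T + (~~ fconnect f u v).*2 = fcard f T + 1.
Proof.
move=> f1E; rewrite (@fcard_porbits f (perm injf)) => [|z]; last exact: permE.
rewrite (@fcard_porbits f1 (perm injf * tperm u v)) => [|z]; last first.
  by rewrite permM permE f1E.
have := porbits_tperm_mulr (perm injf) u v; rewrite uv porbit_sym porbit_fconnect.
by rewrite (eq_fconnect (permE injf)).
Qed.

Lemma fcard_comp_tperm : f1 =1 f \o tperm u v ->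
  fcard f1 T + (~~ fconnect f u v).*2 = fcard f T + 1.
Proof.
move=> f1E; rewrite (@fcard_porbits f (perm injf)) => [|z]; last exact: permE.
rewrite (@fcard_porbits f1 (tperm u v * perm injf)) => [|z]; last first.
  by rewrite permM permE f1E.
have := porbits_mul_tperm (perm injf) u v; rewrite /= uv porbit_sym porbit_fconnect.
by rewrite (eq_fconnect (permE injf)).
Qed.

End Transposition.

(** Joining two cycles by a transposition only coarsens the partition into
    cycles, so what was connected stays connected. *)
Lemma fconnect_tperm_merge f f1 u v : injective f -> u != v ->
    f1 =1 tperm u v \o f -> ~~ fconnect f u v ->
  fconnect f1 u v /\ subrel (fconnect f) (fconnect f1).
Proof.
move=> injf uv f1E fuv.
have injf1 : injective f1.
  exact: eq_inj (inj_comp (@perm_inj _ (tperm u v)) injf) (fsym f1E).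
have fE : f =1 tperm u v \o f1 by move=> z /=; rewrite f1E /= tpermK.
have f1uv : fconnect f1 u v.
  have := fcard_tperm_comp injf uv f1E; have := fcard_tperm_comp injf1 uv fE.
  by rewrite fuv; case: (fconnect f1 u v) => //=; lia.
split=> //; apply: connect_sub => x _ /eqP <-.
have: fconnect f1 x (f1 x) by apply: fconnect1.
rewrite f1E /=; case: tpermP => // -> /connect_trans; apply=> //.
by rewrite fconnect_sym.
Qed.

End Cycles.

(** * Local structure of a diagram *)

Section Orbits.

Variables (T : finType) (f : T -> T).
Hypothesis injf : injective f.

Lemma eq_in_fconnect (g : T -> T) x :
  {in fconnect f x, f =1 g} -> fconnect g x =1 fconnect f x.
Proof.
move=> fg y; rewrite [RHS]fconnect_orbit; apply: (@fconnect_cycle _ g (orbit f x)) => //.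
have := cycle_orbit injf x; rewrite /orbit -orderSpred /=.
have: {subset x :: traject f (f x) (order f x).-1 <= fconnect f x}.
  move=> z; rewrite -[x :: _]/(traject f x (order f x).-1.+1) orderSpred.
  by rewrite -/(orbit f x) -fconnect_orbit.
set s := traject _ _ _ => sub.
rewrite -/(cycle (frel f) (x :: s)) -/(cycle (frel g) (x :: s)).
apply: (@sub_in_cycle _ (fconnect f x)); last exact/allP.
by move=> u v fu _ /eqP <-; rewrite /= fg.
Qed.

Lemma order_connect x y : fconnect f x y -> order f x = order f y.
Proof.
move=> xy; apply: eq_card => z; rewrite !inE.
exact: (same_connect (fconnect_sym injf) xy).
Qed.

Lemma orbit_step x : orbit f (f x) = rot 1 (orbit f x).
Proof.
rewrite /orbit -(order_connect (fconnect1 f x)) -orderSpred [in RHS]trajectS rot1_cons.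
by rewrite trajectSr -iterSr orderSpred iter_order.
Qed.

End Orbits.

Section Maps.

Variables (D : finType) (P : diagram D).
Hypotheses (edgeK : involutive (edge P)) (node_inj : injective (node P)).
Implicit Types x y z : D.
Local Notation e := (edge P).
Local Notation n := (node P).

Lemma edge_inj : injective e.
Proof. exact: inv_inj. Qed.

Lemma faceK x : n (face P x) = e x.
Proof. exact: f_finv. Qed.

Lemma face_inj : injective (face P).
Proof. by move=> x y /(finv_inj node_inj) /edge_inj. Qed.

Lemma mem_vertex x y : (y \in vertex P x) = fconnect n x y.
Proof. by rewrite inE. Qed.

Lemma vertex_eq x y : (vertex P x == vertex P y) = fconnect n x y.
Proof.
apply/eqP/idP => [xy|xy]; first by rewrite -mem_vertex xy mem_vertex connect0.
by apply/setP=> z; rewrite !mem_vertex (same_connect (fconnect_sym node_inj) xy).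
Qed.

Lemma vertex_node x : vertex P (n x) = vertex P x.
Proof. by apply/esym/eqP; rewrite vertex_eq fconnect1. Qed.

Lemma vertex_finv_node x : vertex P (finv n x) = vertex P x.
Proof. by rewrite -(vertex_node (finv n x)) (f_finv node_inj). Qed.

Lemma vertex_crosses x y : vertex P x = vertex P y -> crosses P x = crosses P y.
Proof. by move/eqP; rewrite vertex_eq /crosses => /(order_connect node_inj) ->. Qed.

Lemma crosses_node x : crosses P (n x) = crosses P x.
Proof. exact: vertex_crosses (vertex_node x). Qed.

Lemma node4 x : crosses P x -> n (n (n (n x))) = x.
Proof. by move/eqP=> o4; have := iter_order node_inj x; rewrite o4. Qed.

Lemma crosses_uniq x : crosses P x -> uniq [:: x; n x; n (n x); n (n (n x))].
Proof. by move/eqP=> o4; have := orbit_uniq n x; rewrite /orbit o4. Qed.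

Lemma crosses_vertex x y : crosses P x ->
  (vertex P x == vertex P y) = (y \in [:: x; n x; n (n x); n (n (n x))]).
Proof.
by move/eqP=> o4; rewrite vertex_eq fconnect_orbit /orbit o4.
Qed.

Lemma vertex_cases x y : crosses P x -> vertex P y = vertex P x ->
  [\/ y = x, y = n x, y = n (n x) | y = n (n (n x))].
Proof.
move=> cx /esym/eqP; rewrite crosses_vertex // !inE.
by case/or4P=> /eqP; [constructor 1 | constructor 2 | constructor 3 | constructor 4].
Qed.

Lemma finv_node x : crosses P x -> finv n x = n (n (n x)).
Proof. by move=> cx; apply: node_inj; rewrite f_finv // node4. Qed.

Lemma double_pointsP v :
  reflect (exists2 x, crosses P x & v = vertex P x) (v \in double_points P).
Proof.
apply: (iffP imsetP) => [[x]|[x cx ->]]; last by exists x; rewrite ?inE.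
by rewrite inE => cx ->; exists x.
Qed.

Lemma vertex_double_point x : (vertex P x \in double_points P) = crosses P x.
Proof.
apply/double_pointsP/idP => [[y cy /vertex_crosses ->] //|cx].
by exists x.
Qed.

Hypothesis (node24 : forall x, order n x \in [:: 2; 4]).

Lemma node2 x : ~~ crosses P x -> n (n x) = x.
Proof.
move=> cx; have := iter_order node_inj x; have := node24 x.
by rewrite /crosses !inE in cx *; rewrite (negPf cx) orbF => /eqP ->.
Qed.

Lemma node_neq x : n x != x.
Proof.
apply/eqP=> nx; have := node24 x.
have: order n x <= size [:: x].
  by apply: order_le_cycle; rewrite /= ?nx ?eqxx ?inE.
by rewrite !inE /=; case: order => [|[|]].
Qed.

Lemma vertex_opposite x : vertex P (opposite P x) = vertex P x.
Proof. by rewrite /opposite; case: ifP; rewrite !vertex_node. Qed.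

Lemma crosses_opposite x : crosses P (opposite P x) = crosses P x.
Proof. exact: vertex_crosses (vertex_opposite x). Qed.

Lemma oppositeK : involutive (opposite P).
Proof.
move=> x; rewrite [LHS]/opposite crosses_opposite /opposite.
by case: (boolP (crosses P x)) => cx; rewrite ?(node4 cx) ?(node2 cx).
Qed.

Lemma opposite_neq x : opposite P x != x.
Proof.
rewrite /opposite; case: ifPn => cx; last exact: node_neq.
have := crosses_uniq cx; rewrite /= !inE !negb_or => /andP [/and3P [_ xx _] _].
by rewrite eq_sym.
Qed.

Lemma travel_inj : injective (travel P).
Proof. by move=> x y /(inv_inj oppositeK) /edge_inj. Qed.

Lemma travel_reverse x : travel P (e (travel P x)) = e x.
Proof. by rewrite /travel edgeK oppositeK. Qed.

Lemma fconnect_reverse x y :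
  fconnect (travel P) (e x) (e y) = fconnect (travel P) x y.
Proof.
suff sub a b : fconnect (travel P) a b -> fconnect (travel P) (e a) (e b).
  by apply/idP/idP => /sub //; rewrite !edgeK.
move/iter_findex <-; elim: findex => //= k IHk; apply: connect_trans IHk _.
rewrite (fconnect_sym travel_inj) -(travel_reverse (iter k _ a)).
exact: fconnect1.
Qed.

Hypothesis (edge_neq : forall x, e x != x).

(** [edge] conjugates [travel] to its inverse.  If it preserved a traversal, it
    would act on that cycle as a reflection, and fix a dart or exchange a dart
    with its successor; then an edge or a branch would be turned back on itself. *)
Lemma travel_edge_disjoint x : ~~ fconnect (travel P) x (e x).
Proof.
have rev k z : iter k (travel P) (e (iter k (travel P) z)) = e z.
  by elim: k z => // k IHk z; rewrite iterSr iterS travel_reverse IHk.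
apply/negP=> /iter_findex; move: (findex _ _ _) => k Ek.
(* The reflection axis passes through the [j]-th iterate of [x] if [k] is
   even, and through the middle of the next step if [k] is odd. *)
have [j [b kE]] : exists j, exists b : bool, k = b + (j + j).
  by exists k./2, (odd k); rewrite addnn odd_double_half.
have inj_iter i : injective (iter i (travel P)).
  by elim: i => // i IHi y z /travel_inj /IHi.
have: e (iter j (travel P) x) = iter b (travel P) (iter j (travel P) x).
  by apply: (inj_iter j); rewrite rev -Ek kE -!iterD; congr (iter _ _ _); lia.
case: {kE}b; rewrite /= => /esym/eqP; first by rewrite /travel (negPf (opposite_neq _)).
by rewrite eq_sym (negPf (edge_neq _)).
Qed.

End Maps.

(** * Cuts and the Jordan curve theorem *)

Section Euler.

Variables (D : finType).
Implicit Types P Q : diagram D.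

Definition vertices_faces P := fcard (node P) D + fcard (face P) D.

Lemma eq_face P Q : edge P =1 edge Q -> node P =1 node Q -> face P =1 face Q.
Proof. by move=> eE nE z; rewrite /face (eq_finv nE) eE. Qed.

Lemma eq_vertices_faces P Q :
  edge P =1 edge Q -> node P =1 node Q -> vertices_faces P = vertices_faces Q.
Proof.
by move=> eE nE; congr (_ + _); apply: eq_fcard => //; apply: eq_face.
Qed.

(** Euler's inequality, with the components counted by the values of an
    invariant function. *)
Lemma euler_le P : involutive (edge P) -> (forall x, edge P x != x) ->
    injective (node P) ->
  exists g : D -> {set D},
    [/\ forall x, g (edge P x) = g x, forall x, g (node P x) = g x
      & vertices_faces P <= fcard (edge P) D + #|g @: D|.*2].
Proof.
move=> edgeK edge_neq node_inj.
have injf := face_inj edgeK node_inj.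
have [g [gf gn le_g]] := genus_ge0 (perm injf) (perm node_inj).
have gn' x : g (node P x) = g x by rewrite -[RHS]gn permE.
have gf' x : g (face P x) = g x by rewrite -[RHS]gf permE.
exists g; split=> [x||] //; first by rewrite -(faceK node_inj) gn' gf'.
have EE : fcard (edge P) D = #|porbits (perm injf * perm node_inj)%g|.
  by apply: fcard_porbits => x; rewrite permM !permE faceK.
have EF : fcard (face P) D = #|porbits (perm injf)|.
  by apply: fcard_porbits; apply: permE.
have EN : fcard (node P) D = #|porbits (perm node_inj)|.
  by apply: fcard_porbits; apply: permE.
have E2 : fcard (edge P) D * 2 = #|D|.
  apply: fcard_order_set => //; first exact: inv_inj.
  apply/subsetP=> x _; rewrite inE; apply/eqP.
  apply: (@order_cycle _ _ [:: x; edge P x]); rewrite ?inE ?eqxx //=.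
    by rewrite edgeK !eqxx.
  by rewrite inE eq_sym edge_neq.
rewrite -EE -EF -EN -E2 in le_g; rewrite /vertices_faces.
by move: (fcard _ _) (fcard _ _) (fcard _ _) #|_| le_g; lia.
Qed.

End Euler.

Section Cut.

Variables (D : finType) (P : diagram D).
Hypotheses (edgeK : involutive (edge P)) (edge_neq : forall x, edge P x != x).
Hypothesis node_inj : injective (node P).
Implicit Types (x y z : D) (K C : seq D).
Local Notation e := (edge P).
Local Notation n := (node P).

Definition touched K y := (y \in K) || (n (n y) \in K).

(** At each [x] of [K] the vertex is cut into [node x, node (node x)] on one
    side and the two remaining darts on the other, along a line entering by the
    corner [x] and leaving by the opposite corner.  Seifert splices are cuts at
    suitable corners, but a cut at other corners makes sense as well. *)
Definition cut K := Diagram e (fun y => if touched K y then n (n (n y)) else n y).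

Definition corners K := all (crosses P) K && uniq [seq vertex P x | x <- K].

Lemma touched_vertex K y : touched K y -> vertex P y \in [seq vertex P x | x <- K].
Proof.
case/orP=> [/(map_f (vertex P)) //|/(map_f (vertex P))].
by rewrite !(vertex_node node_inj).
Qed.

Lemma touched_cons x K y : crosses P x ->
  touched (x :: K) y = [|| y == x, y == n (n x) | touched K y].
Proof.
move=> cx; have <- : (n (n y) == x) = (y == n (n x)).
  by rewrite -{1}(node4 node_inj cx) !(inj_eq node_inj).
by rewrite /touched !inE; case: (y == x); case: (_ == x); case: (y \in K).
Qed.

Lemma corners_cons x K : corners (x :: K) =
  [&& crosses P x, vertex P x \notin [seq vertex P y | y <- K] & corners K].
Proof.
by rewrite /corners /= -!andbA; congr (_ && _); rewrite andbCA.
Qed.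

Lemma corner_neq x : crosses P x -> x != n (n x).
Proof.
move/crosses_uniq; rewrite /= !inE !negb_or.
by case/andP=> /and3P [].
Qed.

(** Cutting one more vertex is a composition with a transposition, so that the
    cycle counts above apply to the vertices and, inversely, to the faces. *)
Lemma cut_cons x K : corners (x :: K) ->
  node (cut (x :: K)) =1 node (cut K) \o tperm x (n (n x)).
Proof.
rewrite corners_cons => /and3P [cx xK _] y /=; rewrite touched_cons //.
have untouched z : vertex P z = vertex P x -> touched K z = false.
  by move=> vz; apply: contraNF xK; rewrite -vz; apply: touched_vertex.
have nn4 := node4 node_inj cx.
case: tpermP => [->|->|yx ynnx]; rewrite ?eqxx ?orbT /=.
- by rewrite untouched // !vertex_node.
- by rewrite untouched // nn4.
by rewrite (introF eqP yx) (introF eqP ynnx).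
Qed.

Lemma cut_inj K : corners K -> injective (node (cut K)).
Proof.
elim: K => [_|x K IHK cK]; first exact: eq_inj node_inj _.
apply: eq_inj (fsym (cut_cons cK)); apply: inj_comp (@perm_inj _ _).
by apply: IHK; move: cK; rewrite corners_cons => /and3P [].
Qed.

Lemma cut_step x K : corners (x :: K) ->
    let Q := cut K in let Q' := cut (x :: K) in
  [/\ face Q' =1 tperm x (n (n x)) \o face Q,
      fconnect (face Q) x (n (n x)) -> vertices_faces Q' = vertices_faces Q + 2
    & ~~ fconnect (face Q) x (n (n x)) -> vertices_faces Q' = vertices_faces Q].
Proof.
move=> cxK Q Q'; have := cxK; rewrite corners_cons => /and3P [cx xK cK].
have injQ : injective (node Q) by apply: cut_inj.
have injQ' : injective (node Q') by apply: cut_inj.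
have xx := corner_neq cx.
have untouched z : vertex P z = vertex P x -> touched K z = false.
  by move=> vz; apply: contraNF xK; rewrite -vz; apply: touched_vertex.
have faceE : face Q' =1 tperm x (n (n x)) \o face Q.
  move=> z; apply: (injQ'); rewrite [LHS](faceK injQ').
  by rewrite cut_cons //= tpermK -[RHS]/(node Q (face Q z)) faceK.
have vQ : fcard (node Q') D = fcard (node Q) D + 1.
  have := fcard_comp_tperm injQ xx (cut_cons cxK).
  suff -> : fconnect (node Q) x (n (n x)) by rewrite addn0.
  have nE z : vertex P z = vertex P x -> node Q z = n z.
    by move=> vz; rewrite /= untouched.
  by rewrite -(nE (n x)) ?vertex_node // -(nE x) //; apply: (fconnect_iter _ 2).
have := fcard_tperm_comp (face_inj (P := Q) edgeK injQ) xx faceE.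
rewrite /vertices_faces vQ => faceC; split=> // [xf|/negPf xf];
  move: faceC; rewrite xf /=;
  by move: (fcard (face Q') D) (fcard (face Q) D) (fcard (node Q) D); lia.
Qed.

(** A cut at opposite corners merges their faces if these differ, and splits
    their common face otherwise.  As it also adds a vertex, V + F is kept in the
    first case and grows by 2 in the second. *)
Lemma cut_merges_or_splits K : corners K ->
  vertices_faces P + 2 <= vertices_faces (cut K) \/
  [/\ vertices_faces (cut K) = vertices_faces P,
      subrel (fconnect (face P)) (fconnect (face (cut K)))
    & {in K, forall x, fconnect (face (cut K)) x (n (n x))}].
Proof.
elim: K => [_|x K IHK cxK]; first by right; split.
have := cxK; rewrite corners_cons => /and3P [cx _ cK].
have [faceE same diff] := cut_step cxK.
have [xx|xx] := boolP (fconnect (face (cut K)) x (n (n x))).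
  left; rewrite (same xx); case: (IHK cK) => [le2|[-> _ _]] //.
  exact: leq_trans le2 (leq_addr _ _).
case: (IHK cK) => [le2|[vfE sub KK]]; first by left; rewrite (diff xx).
have injf : injective (face (cut K)) by apply: face_inj => //; apply: cut_inj.
have [xx' sub'] := fconnect_tperm_merge injf (corner_neq cx) faceE xx.
right; split=> [|y z /sub /sub' //|y]; first by rewrite (diff xx).
by rewrite inE => /predU1P [->|/KK /sub'].
Qed.

(** An arc of a curve inside the faces survives all merges, and the curve then
    runs through a cut vertex inside a face. *)
Lemma joined_trail (f : D -> D) x K y :
    subrel (fconnect (face P)) (fconnect f) ->
    {in K, forall z, fconnect f z (n (n z))} ->
  path (joined P) x K -> joined P (last x K) y -> fconnect f (n (n x)) y.
Proof.
move=> sub; elim: K x => /= [|z K IHK] x KK; first by move=> _ /sub.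
case/andP=> /sub xz pathK lastK; apply: connect_trans xz _.
apply: connect_trans (KK z (mem_head _ _)) _; apply: IHK => // t tK.
by apply: KK; rewrite inE tK orbT.
Qed.

(** Cut at all points of the curve but the first, [x].  If only merges occurred,
    the curve now runs from [node (node x)] back to [x] within one face, so the
    cut at [x] splits a face.  In any case a split occurs, and the cut map is
    disconnected.  The component of a dart gives the side function [s], which may
    a priori ignore some points of [C]. *)
Lemma jordan C : spherical P -> C != [::] -> corners C -> cycle (joined P) C ->
  exists s : D -> bool,
    [/\ forall y, s (e y) = s y, forall y, s (n y) != s y -> touched C y
      & exists y z, s y != s z].
Proof.
case: C => // x K sphP _ cxK cycK.
have := cxK; rewrite corners_cons => /and3P [cx _ cK].
have [_ same diff] := cut_step cxK.
have vfP : vertices_faces P = fcard e D + 2 by [].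
have vfC : fcard e D + 4 <= vertices_faces (cut (x :: K)).
  case: (cut_merges_or_splits cK) => [le2|[vfE sub KK]].
    rewrite vfP -addnA in le2; apply: leq_trans le2 _.
    have [/same ->|/diff ->] := boolP (fconnect (face (cut K)) x (n (n x))) => //.
    exact: leq_addr.
  rewrite same ?vfE ?vfP -?addnA //.
  have injf : injective (face (cut K)) by apply: face_inj => //; apply: cut_inj.
  rewrite fconnect_sym //; move: cycK; rewrite /= rcons_path => /andP [pathK lastK].
  exact: joined_trail sub KK pathK lastK.
have [g [ge gn]] := euler_le (P := cut (x :: K)) edgeK edge_neq (cut_inj cxK).
rewrite -/e => le_g; have im_g : 1 < #|g @: D|.
  by move: vfC le_g; move: (vertices_faces _) (fcard _ _) #|g @: D|; lia.
case/card_gt1P: im_g => _ [_ [/imsetP [y _ ->] /imsetP [z _ ->] gyz]].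
exists (fun t => g t == g y); split=> [t|t|]; first by rewrite ge.
  apply: contraR => /negPf touchN.
  by have := gn t; rewrite /= touchN => ->.
by exists y, z; rewrite eqxx (eq_sym (g z)) (negPf gyz).
Qed.

End Cut.

(** * The sides of a curve *)

(** This is where a bound on the number of points of the curve is used: on a
    cycle of three points any two are adjacent. *)
Lemma next_or_next (T : eqType) (C : seq T) x y :
    uniq C -> size C <= 3 -> x \in C -> y \in C -> x != y ->
  (y == next C x) || (x == next C y).
Proof.
case: C => [|a [|b [|c [|d C]]]] //=; rewrite !inE.
- by move=> _ _ /eqP -> /eqP ->; rewrite eqxx.
- rewrite andbT => ab _ /orP [] /eqP -> /orP [] /eqP ->; rewrite ?eqxx ?orbT //.
rewrite negb_or andbT => /andP [/andP [ab ac] bc] _.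
have [ba ca cb] : [/\ b != a, c != a & c != b] by split; rewrite eq_sym.
move=> /or3P [] /eqP -> /or3P [] /eqP -> //;
by rewrite ?eqxx ?(negPf ab) ?(negPf ac) ?(negPf bc) ?(negPf ba) ?(negPf ca)
  ?(negPf cb) ?eqxx ?orbT.
Qed.

Lemma uniq_map_inj (T1 T2 : eqType) (f : T1 -> T2) (r : seq T1) :
  uniq [seq f x | x <- r] -> {in r &, injective f}.
Proof.
elim: r => //= a r IHr /andP [fa /IHr injr] x y.
rewrite !inE => /predU1P [->|xr] /predU1P [->|yr] fxy //; last exact: injr.
  by rewrite fxy map_f in fa.
by rewrite -fxy map_f in fa.
Qed.

Section Sides.

Variables (D : finType) (P : diagram D).
Hypotheses (edgeK : involutive (edge P)) (edge_neq : forall x, edge P x != x).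
Hypothesis node_inj : injective (node P).
Implicit Types (x y z : D) (K C : seq D) (s : D -> bool).
Local Notation e := (edge P).
Local Notation n := (node P).

Lemma reducibleP :
  reducible P <-> exists2 x, crosses P x & fconnect (face P) (n (n x)) x.
Proof.
split=> [[c [_ [C [[cC uC jC _] CE]]]]|[x cx xx]]; last first.
  exists (vertex P x); split; first by rewrite vertex_double_point.
  exists [:: x]; split.
    split; rewrite /= ?cx ?andbT //.
    by move=> y z; rewrite !inE => /eqP -> /eqP ->; rewrite eqxx.
  by apply/setP=> v; rewrite inE; apply/imsetP/eqP => [[y]|->];
     [rewrite inE => /eqP -> | exists x; rewrite ?inE].
have vC y : y \in C -> vertex P y = c.
  by move=> yC; apply/set1P; rewrite -CE; apply: imset_f.
case: C => [|x [|y C]] in cC uC jC CE vC *.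
- by have := set11 c; rewrite -CE => /imsetP [].
- by move: cC jC; rewrite /= !andbT; exists x.
by move: uC; rewrite /= (vC x) ?(vC y) ?mem_head // !inE ?eqxx ?orbT.
Qed.

(** A diagram consisting of a single curve is connected. *)
Lemma single_curve_const (T : Type) (g : D -> T) : single_curve P ->
  (forall x, g (e x) = g x) -> (forall x, g (n x) = g x) -> forall x y, g x = g y.
Proof.
move=> conP ge gn x y.
have gt z : g (travel P z) = g z.
  by rewrite /travel /opposite; case: ifP; rewrite ?gn ge.
have gc z t : fconnect (travel P) z t -> g z = g t.
  by move/iter_findex <-; elim: findex => //= k IHk; rewrite gt.
by case/orP: (conP x y) => /gc // ->; rewrite ge.
Qed.

(** Walk around the faces making up [A]: [s] is constant along each edge, so it
    can change only at a corner, and it changes as often one way as the other. *)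
Lemma face_balance s (A : pred D) : (forall y, s (e y) = s y) ->
    (forall v, A (face P v) = A v) ->
  #|[pred v | [&& A v, s v & ~~ s (n v)]]|
    = #|[pred v | [&& A v, ~~ s v & s (n v)]]|.
Proof.
move=> se Af; have injf := face_inj edgeK node_inj.
pose U := [pred v | A v && s v]; pose V := [pred v | A v && s (n v)].
have UV : #|U| = #|V|.
  rewrite -(card_imset U injf); apply: eq_card => v; rewrite inE [in RHS]/=.
  apply/imsetP/andP => [[z /andP [Az sz] ->]|[Av sv]].
    by rewrite Af faceK // se.
  exists (finv (face P) v); last by rewrite f_finv.
  by rewrite inE -Af f_finv // Av -se -faceK // f_finv.
have := cardID [pred v | s (n v)] U; rewrite UV -(cardID s V).
have -> : #|[predI U & [pred v | s (n v)]]| = #|[predI V & s]|.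
  by apply: eq_card => v; rewrite !inE -!andbA [s v && _]andbC.
move/addnI => UVD.
transitivity #|[predD U & [pred v | s (n v)]]|.
  by apply: eq_card => v; rewrite !inE; case: (s v); case: (s (n v)); rewrite ?andbF.
rewrite UVD; apply: eq_card => v; rewrite !inE.
by case: (s (n v)); rewrite ?andbF ?andbT // andbC.
Qed.

Lemma face_parity s w : (forall y, s (e y) = s y) -> s (n w) != s w ->
  exists w', [/\ fconnect (face P) w w', s (n w') != s w' & s w' != s w].
Proof.
move=> se sw; have injf := face_inj edgeK node_inj.
have bal := face_balance se (fun v => esym (same_fconnect1_r injf w v)).
case sw1: (s w) in sw *.
  have : 0 < #|[pred v | [&& fconnect (face P) w v, s v & ~~ s (n v)]]|.
    by apply/card_gt0P; exists w; rewrite inE connect0 sw1; case: (s (n w)) sw.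
  rewrite bal => /card_gt0P [w']; rewrite inE => /and3P [ww' nsw' snw'].
  by exists w'; rewrite snw' (negPf nsw').
have : 0 < #|[pred v | [&& fconnect (face P) w v, ~~ s v & s (n v)]]|.
  by apply/card_gt0P; exists w; rewrite inE connect0 sw1; case: (s (n w)) sw.
rewrite -bal => /card_gt0P [w']; rewrite inE => /and3P [ww' sw' nsnw'].
by exists w'; rewrite sw' (negPf nsnw').
Qed.

(** [s] tells the two sides of [C] apart: around a vertex it changes exactly at
    the corners through which [C] passes. *)
Definition sided s C :=
  (forall y, s (e y) = s y) /\ (forall y, (s (n y) != s y) = touched P C y).

Lemma corners_uniq C : corners P C -> uniq C.
Proof. by case/andP=> _ /map_uniq. Qed.

Lemma corners_crosses C x : corners P C -> x \in C -> crosses P x.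
Proof. by case/andP=> /allP cC _ /cC. Qed.

Lemma corners_crosses_opposite C x : corners P C -> n (n x) \in C -> crosses P x.
Proof. by move=> cC /(corners_crosses cC); rewrite !crosses_node. Qed.

Lemma corners_inj C : corners P C -> {in C &, injective (vertex P)}.
Proof. by case/andP=> _ /uniq_map_inj. Qed.

Lemma touched_corner C x y : corners P C -> x \in C -> vertex P y = vertex P x ->
  touched P C y = (y == x) || (y == n (n x)).
Proof.
move=> cC xC vy; have cx := corners_crosses cC xC.
have nn4 := node4 node_inj cx.
apply/orP/orP => [[yC|yC]|[/eqP ->|/eqP ->]]; [left|right|by left|].
- by rewrite (corners_inj cC yC xC vy).
- have := corners_inj cC yC xC; rewrite !vertex_node // => /(_ vy) <-.
  by rewrite (node4 node_inj) // (vertex_crosses node_inj vy).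
by right; rewrite nn4.
Qed.

Lemma touched_around C x : corners P C -> x \in C ->
  [/\ touched P C x, touched P C (n x) = false, touched P C (n (n x))
    & touched P C (n (n (n x))) = false].
Proof.
move=> cC xC; have cx := corners_crosses cC xC.
rewrite !(touched_corner cC xC) ?vertex_node // !eqxx orbT.
have := crosses_uniq cx; rewrite /= !inE !negb_or andbT.
case/and3P=> /and3P [/negPf x1 _ /negPf x3] /andP [/negPf x12 _] /negPf x23.
split=> //; first by rewrite eq_sym x1 x12.
by rewrite eq_sym x3 eq_sym x23.
Qed.

(** At a point of [C] the function [s] is constant on each half of the cut
    vertex, so it changes at both corners or at neither. *)
Lemma jump_opposite s C x : corners P C ->
    (forall y, s (n y) != s y -> touched P C y) -> x \in C ->
  (s (n (n (n x))) != s (n (n x))) = (s (n x) != s x).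
Proof.
move=> cC sub xC; have cx := corners_crosses cC xC; have nn4 := node4 node_inj cx.
have untouched y : vertex P y = vertex P x -> y != x -> y != n (n x) -> s (n y) = s y.
  move=> vy yx ynnx; apply/eqP; apply: contraNT yx => /sub.
  by rewrite (touched_corner cC xC vy) (negPf ynnx) orbF.
have := crosses_uniq cx; rewrite /= !inE !negb_or andbT.
case/and3P=> /and3P [xnx xnnx xnnnx] /andP [nxnnx nxnnnx] nnxnnnx.
have := untouched (n x); have := untouched (n (n (n x))).
rewrite !vertex_node // nn4 !(eq_sym _ x) ?(eq_sym _ (n (n x))) xnx xnnnx nnxnnnx.
rewrite (eq_sym _ (n x)) nxnnx.
by move=> <- // -> //; rewrite eq_sym.
Qed.

Lemma jumps_sided s C : corners P C -> (forall y, s (e y) = s y) ->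
    (forall y, s (n y) != s y -> touched P C y) ->
  sided s [seq x <- C | s (n x) != s x].
Proof.
move=> cC se sub; split=> // y; rewrite /touched !mem_filter.
apply/idP/orP => [sy|[/andP [] //|/andP [sy yC]]].
  have /orP [yC|yC] := sub y sy; [left|right]; rewrite ?yC andbT //.
  have cy := corners_crosses_opposite cC yC.
  by rewrite -(jump_opposite cC sub yC) (node4 node_inj cy).
have cy := corners_crosses_opposite cC yC.
by rewrite -(jump_opposite cC sub yC) (node4 node_inj cy) in sy.
Qed.

Hypothesis reduP : forall x, crosses P x -> ~~ fconnect (face P) (n (n x)) x.

(** Two arcs of [C] in the same face would put both corners of some point of
    [C] in one face, and make that point nugatory. *)
Lemma distinct_faces C : corners P C -> cycle (joined P) C -> size C <= 3 ->
  {in C &, forall x y, x != y -> ~~ fconnect (face P) (n (n x)) (n (n y))}.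
Proof.
move=> cC jC sC; have injf := face_inj edgeK node_inj.
have step x y : x \in C -> y \in C -> y == next C x ->
    ~~ fconnect (face P) (n (n x)) (n (n y)).
  move=> xC yC /eqP yE; have := next_cycle jC xC; rewrite -yE /joined => xy.
  rewrite fconnect_sym //; apply: contra (reduP (corners_crosses cC yC)).
  by move/connect_trans; apply.
move=> x y xC yC xy.
have := next_or_next (corners_uniq cC) sC xC yC xy.
by case/orP => [/step|/step]; [apply | rewrite fconnect_sym //; apply].
Qed.

Lemma admissible_small C : corners P C -> cycle (joined P) C -> size C <= 3 ->
  admissible P C.
Proof.
move=> cC jC sC; have /andP [aC uC] := cC; split=> // x y xC yC xy.
by rewrite /disjoint_arcs (negPf (distinct_faces cC jC sC xC yC xy)).
Qed.

(** The function given by [jordan] changes somewhere, by connectedness.  Each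
    face contains at most one arc of [C], and by [face_parity] a change at one end
    of the arc forces a change at the other, so changes propagate along [C]. *)
Lemma exists_sided C : single_curve P -> spherical P -> C != [::] ->
    corners P C -> cycle (joined P) C -> size C <= 3 ->
  exists s, sided s C.
Proof.
move=> conP sphP C0 cC jC sC.
have [s [se sub [a [b ab]]]] := jordan edgeK edge_neq node_inj sphP C0 cC jC.
have uC := corners_uniq cC; have injf := face_inj edgeK node_inj.
have distC := distinct_faces cC jC sC.
have sep_nn x : x \in C -> _ := jump_opposite cC sub.
have sep_next x : x \in C -> s (n x) != s x -> s (n (next C x)) != s (next C x).
  move=> xC sx; have cx := corners_crosses cC xC.
  have [|w [xw sw sw']] := face_parity (w := n (n x)) se; first by rewrite sep_nn.
  have /orP [wC|wC] := sub w sw.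
    have px : prev C w = x.
      apply/eqP; apply: contraT => /distC; rewrite mem_prev => /(_ wC xC) /negP [].
      have := prev_cycle jC wC; rewrite /joined => /connect_trans; apply.
      by rewrite fconnect_sym.
    by rewrite -px next_prev.
  have wE : w = n (n (n (n w))).
    by rewrite (node4 node_inj) // (corners_crosses_opposite cC).
  have [wx|] := eqVneq x (n (n w)).
    by move: sw'; rewrite [in s w]wE -wx eqxx.
  by move/(distC _ _ xC wC)/negP; rewrite -wE.
have sepC x y : x \in C -> s (n x) != s x -> y \in C -> s (n y) != s y.
  move=> xC sx yC.
  have: fconnect (next C) x y by rewrite (fconnect_cycle (cycle_next uC) xC).
  move/iter_findex <-; set k := findex _ _ _.
  suff: (iter k (next C) x \in C) && (s (n (iter k (next C) x)) != s (iter k (next C) x)).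
    by case/andP.
  elim: k => [|k /andP [kC sk]] /=; first by rewrite xC.
  by rewrite mem_next kC sep_next.
have [x xC sx] : exists2 x, x \in C & s (n x) != s x.
  have [y sy|s0] := pickP [pred y | s (n y) != s y]; last first.
    case/negP: ab; apply/eqP; apply: (single_curve_const conP se) => y.
    by apply/eqP/negPn/negbT/s0.
  have /orP [yC|yC] := sub y sy; first by exists y.
  have cy := corners_crosses_opposite cC yC.
  by exists (n (n y)); rewrite // -sep_nn // (node4 node_inj cy).
exists s; split=> // y; apply/idP/idP => [/sub //|/orP [yC|yC]].
  exact: sepC sx yC.
have cy := corners_crosses_opposite cC yC.
by rewrite -(node4 node_inj cy) sep_nn ?(sepC _ _ xC sx yC).
Qed.

Hypothesis (node24 : forall x, order n x \in [:: 2; 4]).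

(** A strand of the diagram crosses [C] at each point of [C]. *)
Lemma sided_opposite s C z : corners P C -> sided s C ->
  s (opposite P z) = s z (+) (vertex P z \in [seq vertex P x | x <- C]).
Proof.
move=> cC [se sn].
have sN y : s (n y) = s y (+) touched P C y.
  by rewrite -sn; case: (s y); case: (s (n y)).
rewrite /opposite; case: ifPn => cz; last first.
  have ->: (vertex P z \in [seq vertex P x | x <- C]) = false.
    apply: contraNF cz => /mapP [x /(corners_crosses cC) cx] /(vertex_crosses node_inj).
    by rewrite cx.
  rewrite sN; case tz: (touched P C z) => //; case/negP: cz.
  have /mapP [x /(corners_crosses cC) cx] := touched_vertex node_inj tz.
  by move/(vertex_crosses node_inj) => ->.
rewrite !sN -addbA; congr (_ (+) _).
case: (boolP (vertex P z \in _)) => [/mapP [x xC vz]|vC]; last first.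
  have out y : vertex P y = vertex P z -> touched P C y = false.
    by move=> vy; apply: contraNF vC => /(touched_vertex node_inj); rewrite vy.
  by rewrite !out ?vertex_node.
have nn4 := node4 node_inj (corners_crosses cC xC).
have [t0 t1 t2 t3] := touched_around cC xC.
by case: (vertex_cases node_inj (corners_crosses cC xC) vz) => ->;
  rewrite ?nn4 ?t0 ?t1 ?t2 ?t3.
Qed.

End Sides.

(** * Cyclic words *)

Section FirstReturn.

Variables (T : eqType) (g : T -> T) (a : pred T) (R : rel T).

(** The accumulated [u] is the part of the walk since the last visit to [a]. *)
Lemma path_filter_return (r : seq T) y u z :
    a y -> all (predC a) u -> a z -> fpath g y (u ++ rcons r z) ->
    {in y :: r, forall y' u' z', a y' -> all (predC a) u' -> a z' ->
      fpath g y' (rcons u' z') -> R y' z'} ->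
  path R y (rcons [seq w <- r | a w] z).
Proof.
elim: r y u => [|w r IHr] y u ay au az gu HR /=.
  by rewrite /= cats1 in gu; rewrite (HR y (mem_head _ _) u z).
have gu' : fpath g y (rcons u w ++ rcons r z) by rewrite cat_rcons.
case: ifPn => aw /=; last first.
  apply: IHr gu' _ => //; first by rewrite all_rcons /= aw.
  move=> y' y'r; apply: HR; move: y'r; rewrite !inE.
  by case/orP=> ->; rewrite ?orbT.
move: gu'; rewrite cat_path last_rcons => /andP [gw gr].
rewrite (HR y (mem_head _ _) u w) //=.
apply: (IHr w [::]) => // y' y'r; apply: HR; move: y'r; rewrite !inE => ->.
by rewrite orbT.
Qed.

(** Consecutive visits to [a] of a periodic orbit are related as soon as every
    visit is related to the next one by the walk between them. *)
Lemma cycle_filter_return (r : seq T) : fcycle g r ->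
    {in r, forall y u z, a y -> all (predC a) u -> a z ->
      fpath g y (rcons u z) -> R y z} ->
  cycle R [seq w <- r | a w].
Proof.
move=> gr HR; have [/hasP [y yr ay]|/hasPn ar] := boolP (has a r); last first.
  by rewrite (@eq_in_filter _ _ pred0) ?filter_pred0 // => w /ar /negPf.
have [i r' rE] := rot_to yr.
rewrite -(rot_cycle (size [seq w <- take i r | a w])).
have -> : rot (size [seq w <- take i r | a w]) [seq w <- r | a w]
            = [seq w <- rot i r | a w].
  by rewrite -{2}(cat_take_drop i r) !filter_cat rot_size_cat.
move: gr; rewrite -(rot_cycle i) rE /= ay /= => gr.
apply: (@path_filter_return r' y [::]) => // w wr; apply: HR.
by rewrite -(mem_rot i) rE.
Qed.

End FirstReturn.

Lemma fpath_map (T : eqType) (g : T -> T) (r : seq T) x :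
  fpath g x r -> r = [seq g y | y <- belast x r].
Proof. by elim: r x => //= y r IHr x /andP [/eqP <- /IHr {1}->]. Qed.

Lemma derangement2 (T : eqType) (a b a' b' : T) :
  perm_eq [:: a; b] [:: a'; b'] -> a' != a -> b' != b -> a' = b /\ b' = a.
Proof.
move=> ab aa bb; have := perm_mem ab a'; have := perm_mem ab b'.
by rewrite !inE (negPf aa) (negPf bb) !eqxx ?orbT ?orbF /= => /eqP -> /eqP ->.
Qed.

(** A permutation of three elements without fixed point is a 3-cycle. *)
Lemma derangement3 (T : eqType) (a b c a' b' c' : T) :
    perm_eq [:: a; b; c] [:: a'; b'; c'] -> a' != a -> b' != b -> c' != c ->
  [/\ a' = b, b' = c & c' = a] \/ [/\ a' = c, c' = b & b' = a].
Proof.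
move=> abc aa bb cc; have := perm_mem abc a'.
rewrite !inE (negPf aa) eqxx /= => /orP [] /eqP a'E; rewrite {}a'E in abc aa *.
  left; move: abc; rewrite -[[:: a; b; c]]/([:: a] ++ [:: b] ++ [:: c]) perm_catCA.
  rewrite perm_cons => ac; have := perm_mem ac c'.
  rewrite !inE (negPf cc) eqxx !orbT orbF => /eqP c'E; rewrite c'E in ac *.
  move: ac; rewrite perm_sym -[[:: b'; a]]/(rcons [:: b'] a) perm_rcons perm_cons.
  by move/perm_mem/(_ b'); rewrite !inE eqxx => /esym/eqP.
right; move: abc; rewrite -[[:: a; b; c]]/(rcons [:: a; b] c) perm_rcons perm_cons.
move=> ab; have := perm_mem ab b'.
rewrite !inE (negPf bb) eqxx orbF /= => /eqP b'E; rewrite b'E perm_cons in ab *.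
by move/perm_mem/(_ b): ab; rewrite !inE eqxx => /esym/eqP.
Qed.

(** The passages through two double points, labelled 0 and 1, each with the side
    of the curve on which it departs.  The passages through 0 depart on different
    sides; starting from 0, eight cases of signs remain to be enumerated. *)
Lemma alternating_word4 b0 b1 b2 (u : seq (nat * bool)) :
    perm_eq u [:: (0, b0); (0, ~~ b0); (1, b1); (1, b2)] ->
    cycle (fun i j => j.2 == ~~ i.2) u -> (head (1, true) u).1 = 0 ->
  [seq i.1 | i <- u] \in [:: [:: 0; 1; 1; 0]; [:: 0; 0; 1; 1]].
Proof.
move=> uperm altu /eqP hu; move: altu hu.
have : u \in permutations [:: (0, b0); (0, ~~ b0); (1, b1); (1, b2)].
  by rewrite mem_permutations.
move: u {uperm}; pose good u := cycle (fun i j : nat * bool => j.2 == ~~ i.2) u ==>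
  ((head (1, true) u).1 == 0) ==>
  ([seq i.1 | i <- u] \in [:: [:: 0; 1; 1; 0]; [:: 0; 0; 1; 1]]).
have /allP ok : all good (permutations [:: (0, b0); (0, ~~ b0); (1, b1); (1, b2)]).
  by case: b0 b1 b2 => [] [] []; vm_compute.
by move=> u /ok /implyP good1 alt hu; apply: (implyP (good1 alt)).
Qed.

(** As above with three double points, where moreover the passages through
    each of the labels 0 and 1 are not consecutive. *)
Lemma alternating_word6 b0 b1 b2 b3 (u : seq (nat * bool)) :
    perm_eq u [:: (0, b0); (0, ~~ b0); (1, b1); (1, ~~ b1); (2, b2); (2, b3)] ->
    cycle (fun i j => j.2 == ~~ i.2) u ->
    cycle (fun i j => (i.1 == j.1) && (i.1 < 2) ==> (i == j)) u ->
    (head (1, true) u).1 = 0 ->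
  [seq i.1 | i <- u] \in [:: [:: 0; 1; 2; 0; 1; 2]; [:: 0; 2; 1; 0; 2; 1]].
Proof.
set l := [:: _; _; _; _; _; _]; move=> uperm altu noru /eqP hu; move: altu noru hu.
have : u \in permutations l by rewrite mem_permutations.
move: u {uperm}; pose good u := cycle (fun i j : nat * bool => j.2 == ~~ i.2) u ==>
  cycle (fun i j : nat * bool => (i.1 == j.1) && (i.1 < 2) ==> (i == j)) u ==>
  ((head (1, true) u).1 == 0) ==>
  ([seq i.1 | i <- u] \in [:: [:: 0; 1; 2; 0; 1; 2]; [:: 0; 2; 1; 0; 2; 1]]).
have /allP ok : all good (permutations l).
  by rewrite {}/l; case: b0 b1 b2 b3 => [] [] [] []; vm_compute.
move=> u /ok /implyP good1 alt nor hu.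
exact: (implyP (implyP (good1 alt) nor)).
Qed.

Lemma head_filter_orbit (T : finType) (f : T -> T) (a : pred T) x :
  a x -> exists r, [seq y <- orbit f x | a y] = x :: r.
Proof. by move=> ax; rewrite /orbit -orderSpred /= ax; eexists. Qed.


(** * Directions along a knot projection *)

Section KnotProjection.

Variables (D : finType) (P : diagram D).
Hypothesis hP : knot_projection P.
Implicit Types (x y z : D) (K C L Z : seq D) (s : D -> bool) (S : {set {set D}}).
Local Notation e := (edge P).
Local Notation n := (node P).
Local Notation t := (travel P).
Local Notation same := (fconnect (travel P)).

Let edgeK : involutive e. Proof. by case: hP => [[]]. Qed.
Let edge_neq x : e x != x. Proof. by case: hP => [[]]. Qed.
Let node_inj : injective n. Proof. by case: hP => _ []. Qed.
Let node24 x : order n x \in [:: 2; 4]. Proof. by case: hP => _ []. Qed.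
Let conP : single_curve P. Proof. by case: hP. Qed.
Let sphP : spherical P. Proof. by case: hP. Qed.
Let injt : injective t. Proof. exact: travel_inj. Qed.
Let injf : injective (face P). Proof. exact: face_inj. Qed.
Let symt x y : same x y = same y x. Proof. exact: fconnect_sym. Qed.

Lemma vertex_travel x : vertex P (t x) = vertex P (e x).
Proof. exact: vertex_opposite. Qed.

Lemma same_edge x y : same x (e y) = ~~ same x y.
Proof.
have := conP x y; case xy: (same x y); case xey: (same x (e y)) => // _.
by case/negP: (travel_edge_disjoint edgeK node_inj node24 edge_neq y);
   apply: connect_trans xey; rewrite symt.
Qed.

Lemma same_opposite x y : same x (opposite P y) = ~~ same x y.
Proof. by rewrite -same_edge [RHS](same_fconnect1_r injt) /travel edgeK. Qed.

Lemma same_node2 x y : crosses P y -> same x (n (n y)) = ~~ same x y.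
Proof. by move=> cy; rewrite -same_opposite /opposite cy. Qed.

(** The darts [x] and [node x] are both departing, or both arriving. *)
Definition coherent x := same x (n x).

(** Reversing the orientation of the curve preserves coherence, so it can be
    tested with the orientation given by any [x]. *)
Lemma coherentE x y : coherent y = (same x y == same x (n y)).
Proof.
have xx z w : same x z = ~~ same x w -> ~~ same z w.
  by move=> zw; apply/negP => /(same_connect_r symt) /(_ x); rewrite zw; case: same.
rewrite /coherent; case xy: (same x y); first exact/esym/(same_connect symt).
case xny: (same x (n y)) => /=.
  by apply/negP => yny; move: xy; rewrite (same_connect_r symt yny) xny.
have xey : same x (e y) by rewrite same_edge xy.
by rewrite -fconnect_reverse // -(same_connect symt xey) same_edge xny.
Qed.

Lemma coherent_node x : crosses P x -> coherent (n x) = ~~ coherent x.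
Proof.
by move=> cx; rewrite !(coherentE x) same_node2 // connect0; case: (same x (n x)).
Qed.

Lemma exists_coherent x : crosses P x ->
  exists z, [/\ vertex P z = vertex P x, crosses P z & coherent z].
Proof.
move=> cx; have [cohx|ncohx] := boolP (coherent x); first by exists x.
by exists (n x); rewrite vertex_node // crosses_node // coherent_node.
Qed.

(** The neighbour of [x] that departs if [x] departs: the beginning of the
    second passage of the traversal through the same double point. *)
Definition other x := if coherent x then n x else finv n x.

Lemma vertex_other x : vertex P (other x) = vertex P x.
Proof. by rewrite /other; case: ifP; rewrite ?vertex_node ?vertex_finv_node. Qed.

Lemma same_other x : crosses P x -> same x (other x).
Proof.
move=> cx; rewrite /other; case: ifPn => // ncohx.
by rewrite finv_node // same_node2 ?crosses_node.
Qed.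

Lemma other_neq x : crosses P x -> other x != x.
Proof.
move=> cx; have := crosses_uniq cx; rewrite /= !inE !negb_or.
case/andP=> /and3P [x1 _ x3] _.
by rewrite /other eq_sym; case: ifP => // _; rewrite finv_node.
Qed.

Lemma other_unique x y : crosses P x -> vertex P y = vertex P x -> same x y ->
  y != x -> y = other x.
Proof.
move=> cx vy; rewrite /other finv_node //.
case: (vertex_cases node_inj cx vy) => ->; rewrite ?eqxx //.
- by rewrite /coherent => ->.
- by rewrite same_node2 // connect0.
rewrite same_node2 ?crosses_node // => /negPf xnx _.
by rewrite (coherentE x) connect0 xnx.
Qed.

Lemma otherK x : crosses P x -> other (other x) = x.
Proof.
move=> cx; have co : crosses P (other x).
  by rewrite (vertex_crosses node_inj (vertex_other x)).
apply/esym/other_unique => //; first by rewrite vertex_other.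
  by rewrite symt same_other.
by rewrite eq_sym other_neq.
Qed.

(** * Seifert splices *)

Section Splice.

Variable S : {set {set D}}.
Hypothesis subS : S \subset double_points P.
Local Notation Q := (seifert_splice P S).
Local Notation tQ := (travel Q).

Lemma spliced_crosses x : vertex P x \in S -> crosses P x.
Proof. by move/(subsetP subS); rewrite vertex_double_point. Qed.

Lemma seifert_partnerE x : crosses P x -> seifert_partner P x = other (n (n x)).
Proof.
move=> cx; rewrite /other !coherent_node ?crosses_node // negbK.
rewrite /seifert_partner -/(coherent x) !finv_node ?crosses_node //.
by rewrite (node4 node_inj cx).
Qed.

Lemma seifert_partnerK x : crosses P x ->
  seifert_partner P (seifert_partner P x) = x.
Proof.
have pE z : seifert_partner P z = if coherent z then finv n z else n z by [].
move=> cx; rewrite (pE x); case: ifPn => cohx; rewrite pE.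
  rewrite finv_node // !coherent_node ?crosses_node // cohx /=.
  exact: node4.
by rewrite coherent_node // cohx finv_f.
Qed.

(** The Seifert splice joins departing darts to arriving ones, so it separates
    the vertex along a line through its coherent corners. *)
Lemma node_splice_cut K : corners P K -> {in K, forall x, coherent x} ->
    [seq vertex P x | x <- K] =i S ->
  node Q =1 node (cut P K).
Proof.
move=> cK cohK KS y /=; rewrite -KS; case: ifPn => [/mapP [x xK vy]|yK].
  have cx := corners_crosses cK xK.
  have cy : crosses P y by rewrite (vertex_crosses node_inj vy).
  rewrite /seifert_partner -/(coherent y) finv_node //.
  suff -> : touched P K y = coherent y by [].
  have cohx := cohK x xK.
  have [t0 t1 t2 t3] := touched_around node_inj cK xK.
  by case: (vertex_cases node_inj cx vy) => ->;
    rewrite ?t0 ?t1 ?t2 ?t3 ?coherent_node ?crosses_node // cohx.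
have yN : touched P K y = false.
  by apply: contraNF yK; apply: touched_vertex.
by rewrite yN.
Qed.

Lemma node_spliced x : vertex P x \in S -> node Q x = seifert_partner P x.
Proof. by move=> /= ->. Qed.

Lemma node_unspliced x : vertex P x \notin S -> node Q x = n x.
Proof. by move=> /= /negPf ->. Qed.

Lemma crosses_spliced x : vertex P x \in S -> order (node Q) x = 2.
Proof.
move=> xS; have cx := spliced_crosses xS.
have cn : crosses P (n (n x)) by rewrite !crosses_node.
have pE := seifert_partnerE cx.
have vp : vertex P (seifert_partner P x) = vertex P x.
  by rewrite pE vertex_other !vertex_node.
have px : seifert_partner P x != x.
  apply/eqP => px; have := same_other cn; rewrite -pE px symt same_node2 //.
  by rewrite connect0.
apply: (@order_cycle _ _ [:: x; seifert_partner P x]); rewrite ?mem_head //=.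
  by rewrite vp xS seifert_partnerK // !eqxx.
by rewrite inE eq_sym px.
Qed.

Lemma fconnect_unspliced x : vertex P x \notin S ->
  fconnect (node Q) x =1 fconnect n x.
Proof.
move=> xS; apply: eq_in_fconnect => // y xy.
have /eqP vxy : vertex P x == vertex P y by rewrite vertex_eq.
by rewrite node_unspliced // -vxy.
Qed.

Lemma order_unspliced x : vertex P x \notin S -> order (node Q) x = order n x.
Proof. by move=> xS; apply: eq_card; apply: fconnect_unspliced. Qed.

Lemma crosses_splice x : crosses Q x = crosses P x && (vertex P x \notin S).
Proof.
rewrite /crosses; case: (boolP (vertex P x \in S)) => xS.
  by rewrite crosses_spliced // andbF.
by rewrite order_unspliced // andbT.
Qed.

(** A traveller arriving at a spliced point departs as in its other passage
    through that point. *)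
Lemma travel_splice x :
  tQ x = if vertex P (t x) \in S then other (t x) else t x.
Proof.
rewrite vertex_travel /travel -[edge Q x]/(e x) [LHS]/opposite crosses_splice.
have [xS|xS] := boolP (vertex P (e x) \in S).
  have cx := spliced_crosses xS.
  by rewrite andbF node_spliced // seifert_partnerE // /opposite cx.
by rewrite andbT /opposite !node_unspliced ?vertex_node.
Qed.

Lemma fpath_splice y u : all [pred w | vertex P w \notin S] u ->
  fpath tQ y u = fpath t y u.
Proof.
elim: u y => //= w u IHu y /andP [wS /IHu ->]; congr (_ && _).
rewrite travel_splice; apply/eqP/eqP => [|tw].
  case: ifP => // tS ow; case/negP: wS.
  by rewrite -ow vertex_other.
by rewrite tw (negPf wS).
Qed.

Lemma splice_segment y u z : all [pred w | vertex P w \notin S] u ->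
    vertex P z \in S -> fpath t y (rcons u z) ->
  fpath tQ y (rcons u (other z)).
Proof.
move=> uS zS; rewrite !rcons_path fpath_splice // => /andP [-> /eqP tz] /=.
by rewrite travel_splice tz zS.
Qed.

(** The loop from [y] to the next passage through the same point is closed up by
    the splice into a component of its own. *)
Lemma splice_loop_not_single y u : all [pred w | vertex P w \notin S] u ->
    vertex P y \in S -> fpath t y (rcons u (other y)) ->
  ~ single_curve Q.
Proof.
move=> uS yS yu conQ; have cy := spliced_crosses yS.
have oS : vertex P (other y) \in S by rewrite vertex_other.
have cyc : fcycle tQ (y :: u).
  by rewrite /= -{2}(otherK cy); apply: splice_segment.
have yuQ := fconnect_cycle cyc (mem_head _ _).
have same_u w : w \in y :: u -> same y w.
  move=> wu; apply: (path_connect yu).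
  by move: wu; rewrite !inE mem_rcons inE => /orP [->|->]; rewrite ?orbT.
case/orP: (conQ y (other y)); rewrite yuQ.
  rewrite inE (negPf (other_neq cy)) => /(allP uS) /=.
  by rewrite oS.
by move/same_u; rewrite same_edge same_other.
Qed.

Lemma vertex_node_splice z : vertex P (node Q z) = vertex P z.
Proof.
rewrite /= /seifert_partner; case: ifP; last by rewrite vertex_node.
by case: ifP; rewrite ?vertex_node ?vertex_finv_node.
Qed.

Lemma splice_node_inj : injective (node Q).
Proof.
move=> x y xy; have vxy : vertex P x = vertex P y.
  by rewrite -vertex_node_splice xy vertex_node_splice.
move: xy; have [yS|yS] := boolP (vertex P y \in S); last first.
  by rewrite !node_unspliced ?vxy // => /node_inj.
have [cx cy] : crosses P x /\ crosses P y.
  by split; apply: (spliced_crosses); rewrite ?vxy.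
rewrite !node_spliced ?vxy // => /(congr1 (seifert_partner P)).
by rewrite !seifert_partnerK.
Qed.

Lemma splice_node24 x : order (node Q) x \in [:: 2; 4].
Proof.
have [xS|xS] := boolP (vertex P x \in S); last by rewrite order_unspliced.
by rewrite crosses_spliced.
Qed.

(** If both departures from each spliced point belong to the same component,
    then the spliced curve passes wherever the original one does. *)
Lemma splice_swap_single x :
    (forall z, same x z -> vertex P z \in S -> fconnect tQ z (other z)) ->
  single_curve Q.
Proof.
move=> swapS; have edgeQ : involutive (edge Q) := edgeK.
have injQ := splice_node_inj; have Q24 := splice_node24.
have symQ := fconnect_sym (travel_inj edgeQ injQ Q24).
have stepQ y : same x y -> fconnect tQ y (t y).
  move=> xy; have := fconnect1 tQ y; rewrite travel_splice //.
  case: ifP => // tS /connect_trans; apply; rewrite symQ swapS //.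
  by rewrite -(same_fconnect1_r injt).
have subQ y : same x y -> fconnect tQ x y.
  move/iter_findex <-; elim: findex => //= k IHk.
  by apply: connect_trans IHk (stepQ _ _); apply: fconnect_iter.
have subQ2 y z : same x y -> same x z -> fconnect tQ y z.
  by move=> /subQ; rewrite symQ => xy /subQ; apply: connect_trans xy.
have dich y : same x (edge Q y) = ~~ same x y by apply: same_edge.
move=> y z; case xy: (same x y); case xz: (same x z).
- by rewrite subQ2.
- by rewrite [X in _ || X]subQ2 ?orbT // dich xz.
- by rewrite -[X in _ || X]fconnect_reverse // edgeQ [X in _ || X]subQ2 ?orbT // dich xy.
- by rewrite -fconnect_reverse // subQ2 // dich ?xy ?xz.
Qed.

End Splice.

(** * Passages through double points *)

(** A word is read off the darts at which the passages depart. *)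
Lemma met_filter x (w : seq {set D}) :
  [seq v <- [seq vertex P y | y <- orbit t x] | v \in w]
    = [seq vertex P y | y <- [seq y <- orbit t x | vertex P y \in w]].
Proof. by rewrite filter_map. Qed.

Lemma mem_passages x (w : seq {set D}) y :
  (y \in [seq y <- orbit t x | vertex P y \in w]) = (vertex P y \in w) && same x y.
Proof. by rewrite mem_filter fconnect_orbit. Qed.

Definition interlaced p q := met_in_cyclic_order P [:: p; q; p; q].

(** With passages [p1, q1, p2, q2] the spliced curve runs from [p1] to the
    passage through [q] other than [q1], and so on: it visits the four passages
    in the order [p1, q2, p2, q1]. *)
Lemma interlaced_single_curve p q :
    p \in double_points P -> q \in double_points P -> p != q ->
    interlaced p q ->
  single_curve (seifert_splice P [set p; q]).
Proof.
move=> dp dq pq [x]; rewrite met_filter; set S := [set p; q].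
have subS : S \subset double_points P.
  by apply/subsetP => v; rewrite !inE => /orP [] /eqP ->.
set r := filter _ _; case rE: r => [|p1 [|q1 [|p2 [|q2 []]]]] //= [vp1 vq1 vp2 vq2].
have wS v : (v \in [:: p; q; p; q]) = (v \in S).
  by rewrite !inE; case: (v == p); case: (v == q).
have memr y : (y \in r) = (vertex P y \in S) && same x y by rewrite mem_passages wS.
have ur : uniq r by rewrite filter_uniq.
set Q := seifert_splice P S; set tQ := travel Q.
have symQ := fconnect_sym (travel_inj (edgeK : involutive (edge Q))
  (splice_node_inj subS) (splice_node24 subS)).
have cyc : cycle (fun y z => fconnect tQ y (other z)) r.
  apply: cycle_filter_return; first exact: (cycle_orbit injt).
  move=> y _ u z _; rewrite /= wS => uS zS yz.
  have uS' : all [pred w | vertex P w \notin S] u.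
    by apply: sub_all uS => w /=; rewrite wS.
  have := splice_segment subS uS' zS yz.
  by move/path_connect; apply; rewrite inE mem_rcons inE eqxx orbT.
have o (y z : D) : y \in r -> z \in r -> vertex P z = vertex P y -> z != y -> z = other y.
  rewrite !memr => /andP [yS xy] /andP [zS xz] vzy zy.
  apply: other_unique => //; first exact: (spliced_crosses subS).
  by rewrite symt in xy; apply: connect_trans xy xz.
move: ur; rewrite rE /= !inE !negb_or.
case/and4P=> /and3P [_ n13 _] /andP [_ n24] _ _.
have [m1 m2 m3 m4] : [/\ p1 \in r, q1 \in r, p2 \in r & q2 \in r].
  by rewrite rE !inE !eqxx ?orbT.
(* The four departures are exchanged in pairs by [other]. *)
have o1 : p2 = other p1 by apply: o; rewrite ?vp1 ?vp2 // eq_sym.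
have o2 : q2 = other q1 by apply: o; rewrite ?vq1 ?vq2 // eq_sym.
have o3 : p1 = other p2 by apply: o; rewrite ?vp1 ?vp2.
have o4 : q1 = other q2 by apply: o; rewrite ?vq1 ?vq2.
move: cyc; rewrite rE /= -o1 -o2 -o3 -o4 andbT => /and4P [c1 c2 c3 c4].
have c13 := connect_trans c1 c4; have c24 := connect_trans c2 c1.
apply: (splice_swap_single subS (x := x)) => z xz zS.
have : z \in r by rewrite memr zS.
rewrite rE !inE => /or4P [] /eqP ->; rewrite -?o1 -?o2 -?o3 -?o4 //.
  by rewrite symQ.
by rewrite symQ.
Qed.

(** * Splices that make a projection reducible *)

(** A connected splice satisfies Euler's inequality with one component, so the
    cuts at its coherent corners merge faces without ever splitting one. *)
Lemma connected_splice S K : S \subset double_points P ->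
    corners P K -> {in K, forall x, coherent x} -> [seq vertex P x | x <- K] =i S ->
    let Q := seifert_splice P S in single_curve Q ->
  [/\ spherical Q, subrel (fconnect (face P)) (fconnect (face Q))
    & {in K, forall x, fconnect (face Q) x (n (n x))}].
Proof.
move=> subS cK cohK KS Q conQ.
have nodeE : node Q =1 node (cut P K) by apply: node_splice_cut.
have injQ : injective (node Q) by apply: splice_node_inj.
have vfQ : vertices_faces Q = vertices_faces (cut P K) by apply: eq_vertices_faces.
have faceE := @eq_fconnect _ _ _ (@eq_face _ Q (cut P K) (frefl _) nodeE).
have [g [ge gn le_g]] := euler_le (P := Q) edgeK edge_neq injQ.
have im_g : #|g @: D| <= 1.
  rewrite leqNgt; apply/negP => /card_gt1P [_ [_ [/imsetP [y _ ->] /imsetP [z _ ->]]]].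
  by rewrite (single_curve_const conQ ge gn y z) eqxx.
have vfP : vertices_faces P = fcard e D + 2 := sphP.
have {}le_g : vertices_faces (cut P K) <= fcard e D + 2.
  rewrite -vfQ; apply: leq_trans le_g _; rewrite leq_add2l.
  by rewrite -[2]/(1.*2) leq_double.
case: (cut_merges_or_splits edgeK node_inj cK) => [|[vfE sub KK]].
  by move=> /leq_trans /(_ le_g); rewrite vfP -[X in _ <= X]addn0 leq_add2l.
split=> [|x y /sub|x /KK]; rewrite ?faceE //.
by rewrite /spherical -/(vertices_faces Q) vfQ vfE.
Qed.

(** The curve through [z] and the spliced points [L] becomes, after the splice,
    a curve through [z] only. *)
Lemma splice_reducible p q K L z : p \in double_points P -> q \in double_points P ->
    p != q -> interlaced p q -> corners P K -> {in K, forall x, coherent x} ->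
    [seq vertex P x | x <- K] =i [set p; q] ->
    crosses P z -> vertex P z \notin [set p; q] -> {subset L <= K} ->
    cycle (joined P) (z :: L) ->
  made_reducible_by P 2.
Proof.
move=> dp dq pq ipq cK cohK KS cz zS LK cyc; exists [set p; q].
have subS : [set p; q] \subset double_points P.
  by apply/subsetP => v; rewrite !inE => /orP [] /eqP ->.
have conQ : single_curve (seifert_splice P [set p; q]) by apply: interlaced_single_curve.
have [sphQ sub KK] := connected_splice subS cK cohK KS conQ.
set Q := seifert_splice P [set p; q] in conQ sphQ sub KK *.
have injQ : injective (node Q) by apply: splice_node_inj.
have czQ : crosses Q z by rewrite crosses_splice // cz.
have nzQ x : vertex P x = vertex P z -> node Q x = n x.
  by move=> vx; rewrite node_unspliced // vx.
split=> //; first by rewrite cards2 pq.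
  split=> //; [split=> // x; exact: splice_node24|].
  by apply/set0Pn; exists (vertex Q z); rewrite vertex_double_point.
apply/(reducibleP injQ); exists z => //; rewrite !nzQ ?vertex_node //.
move: cyc; rewrite /= rcons_path => /andP [pathL lastL].
by apply: (joined_trail sub _ pathL lastL) => x /LK /KK.
Qed.

(** * Sides along the traversal *)

Lemma mem_meeting C v : (v \in meeting_points P C) = (v \in [seq vertex P x | x <- C]).
Proof.
by apply/imsetP/mapP => -[x xC ->]; exists x.
Qed.

Lemma size_corners C : corners P C -> #|meeting_points P C| = size C.
Proof.
case/andP=> _ uC; rewrite -(size_map (vertex P)) -(card_uniqP uC).
by apply: eq_card => v; rewrite mem_meeting.
Qed.

Lemma sides_alternate s C y u z : corners P C -> sided P s C ->
    vertex P z \in meeting_points P C ->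
    all [pred w | vertex P w \notin meeting_points P C] u -> fpath t y (rcons u z) ->
  s z = ~~ s y.
Proof.
move=> cC sC zC uC yu; have [se _] := sC.
have flip w : s (t w) = s w (+) (vertex P (t w) \in meeting_points P C).
  rewrite vertex_travel // /travel (sided_opposite node_inj _ cC sC).
  by rewrite se mem_meeting.
elim: u y uC yu => [|w u IHu] y /=.
  by move=> _ /andP [/eqP tyz _]; rewrite -tyz flip tyz zC addbT.
case/andP=> wC uC /andP [/eqP tw yu]; rewrite (IHu w) // -tw flip tw (negPf wC).
by rewrite addbF.
Qed.

Lemma passages_alternate s C x (w : seq {set D}) : corners P C -> sided P s C ->
    w =i meeting_points P C ->
  cycle (fun y z => s z == ~~ s y) [seq y <- orbit t x | vertex P y \in w].
Proof.
move=> cC sC wC; apply: cycle_filter_return; first exact: (cycle_orbit injt).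
move=> y _ u z _; rewrite /= !wC => uC zC yu; apply/eqP.
by apply: (sides_alternate cC sC zC _ yu); apply: sub_all uC => v /=; rewrite wC.
Qed.

(** Two consecutive passages through the same spliced point would bound a loop
    that the splice closes up. *)
Lemma passages_no_return S x (w : seq {set D}) : S \subset double_points P ->
    {subset S <= w} -> single_curve (seifert_splice P S) ->
  cycle (fun y z => (vertex P y == vertex P z) && (vertex P y \in S) ==> (y == z))
    [seq y <- orbit t x | vertex P y \in w].
Proof.
move=> subS Sw conQ; apply: cycle_filter_return; first exact: (cycle_orbit injt).
move=> y _ u z _ uw _ yu; apply/implyP => /andP [/eqP vyz yS].
have cy := spliced_crosses subS yS.
have yz : same y z by apply: (path_connect yu); rewrite inE mem_rcons inE eqxx orbT.
apply: contraT; rewrite eq_sym => zy.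
case: (splice_loop_not_single (y := y) (u := u) subS _ _ _ conQ) => //.
  by apply: sub_all uw => v /=; apply: contra; apply: Sw.
by rewrite -(other_unique cy (esym vyz) yz zy).
Qed.

Lemma orbit_other y : crosses P y ->
  exists u1 u2, orbit t y = y :: u1 ++ other y :: u2.
Proof.
move=> cy; have [r rE] : exists r, orbit t y = y :: r.
  by rewrite /orbit -orderSpred; eexists.
have : other y \in orbit t y by rewrite -fconnect_orbit same_other.
rewrite rE inE (negPf (other_neq cy)) /= => /splitPr oy.
by case: oy rE => u1 u2 rE; exists u1, u2.
Qed.

Lemma path_to_other y : crosses P y -> exists2 u,
  all [pred w | vertex P w != vertex P y] u & fpath t y (rcons u (other y)).
Proof.
move=> cy.
have [u1 [u2 rE]] := orbit_other cy.
have := orbit_uniq t y; have := cycle_orbit injt y; rewrite rE => cyc /= /andP [yr ur].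
exists u1; last first.
  move: cyc; rewrite /= rcons_cat cat_path /= => /and3P [yu1 uo _].
  by rewrite rcons_path yu1.
apply/allP => w wu1 /=; apply/eqP => vw.
have yw : same y w by rewrite fconnect_orbit rE inE mem_cat wu1 orbT.
have wy : w != y by apply: contraNneq yr => <-; rewrite mem_cat wu1.
have wE := other_unique cy vw yw wy.
move: ur; rewrite cat_uniq -wE => /and3P [_ /hasPn /(_ w (mem_head _ _))] /=.
by rewrite wu1.
Qed.

(** The loop at a double point becomes a component when that point alone is
    spliced. *)
Lemma not_reducible_by_one : ~ made_reducible_by P 1.
Proof.
case=> S [subS /eqP /cards1P [p SE] [_ _ conQ _ _] _].
have /double_pointsP [y cy pE] : p \in double_points P.
  by apply: (subsetP subS); rewrite SE inE.
have [u uy yu] := path_to_other cy.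
apply: (splice_loop_not_single subS _ _ yu conQ).
  by apply: sub_all uy => w /=; rewrite SE pE inE.
by rewrite SE pE inE.
Qed.

(** Each double point is passed exactly twice. *)
Lemma passages_perm x (w : seq {set D}) L : corners P L ->
    [seq vertex P d | d <- L] =i w -> {in L, forall d, same x d} ->
  perm_eq [seq y <- orbit t x | vertex P y \in w]
    (flatten [seq [:: d; other d] | d <- L]).
Proof.
move=> cL Lw xL.
apply: uniq_perm; first by rewrite filter_uniq.
  elim: L cL {Lw xL} => //= d L IHL; rewrite corners_cons => /and3P [cd dL cL].
  rewrite !inE IHL // andbT negb_or eq_sym (other_neq cd) /=.
  have notin z : vertex P z = vertex P d ->
      z \notin flatten [seq [:: d; other d] | d <- L].
    move=> vz; apply: contra dL => /flatten_mapP [d' d'L].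
    rewrite !inE -vz => /orP [] /eqP ->; rewrite ?vertex_other //; exact: map_f.
  by rewrite !notin ?vertex_other.
move=> y; rewrite mem_passages -Lw; apply/andP/flatten_mapP => [[/mapP [d dL vy] xy]|].
  exists d => //; rewrite !inE; have [//|yd] := eqVneq y d.
  have dy : same d y by have := xL d dL; rewrite symt => /connect_trans; apply.
  have cd := corners_crosses cL dL.
  by rewrite (other_unique cd vy dy yd) eqxx.
case=> d dL; rewrite !inE => /orP [] /eqP ->.
  by split; [apply: map_f | apply: xL].
split; first by rewrite vertex_other //; apply: map_f.
by apply: connect_trans (xL d dL) _; apply: same_other => //; apply: corners_crosses dL.
Qed.

(** A cyclic word can be read from its second letter. *)
Lemma filter_rot1 x (a : pred D) y r : [seq z <- orbit t x | a z] = y :: r ->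
  exists x', [seq z <- orbit t x' | a z] = rcons r y.
Proof.
move=> rE; have [u [v [uvE au vE]]] : exists u v,
    [/\ orbit t x = u ++ y :: v, all (predC a) u & [seq z <- v | a z] = r].
  elim: (orbit t x) rE => //= z l IHl; case: ifPn => az.
    by case=> <- <-; exists [::], l.
  by move/IHl => [u [v [-> au vr]]]; exists (z :: u), v; rewrite /= az.
have orbit_iter k : k <= size (orbit t x) ->
    orbit t (iter k t x) = rot k (orbit t x).
  elim: k => [|k IHk] lek; first by rewrite rot0.
  by rewrite [LHS](orbit_step injt) IHk ?(ltnW lek) // -rotS.
exists (iter (size (rcons u y)) t x); rewrite orbit_iter; last first.
  by rewrite uvE size_rcons size_cat /= addnS ltnS leq_addr.
rewrite uvE -cat_rcons rot_size_cat filter_cat vE filter_rcons.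
have ay : a y by have := mem_head y r; rewrite -rE mem_filter => /andP [].
rewrite ay (@eq_in_filter _ _ pred0) ?filter_pred0 ?cats1 //.
by move=> z /(allP au) /negPf.
Qed.

(** The two departures are neighbours around the vertex, separated by a coherent
    corner; they lie on different sides iff the curve goes through that corner. *)
Lemma sided_other s C x y : corners P C -> sided P s C -> x \in C ->
  vertex P y = vertex P x -> (s (other y) != s y) = coherent x.
Proof.
move=> cC [_ sn] xC vy; have cx := corners_crosses cC xC.
have cy : crosses P y by rewrite (vertex_crosses node_inj vy).
have -> : (s (other y) != s y)
    = if coherent y then touched P C y else touched P C (finv n y).
  rewrite /other; case: ifP => _; first exact: sn.
  by rewrite -sn f_finv // eq_sym.
rewrite finv_node //; have nn4 := node4 node_inj cx.
have [t0 t1 t2 t3] := touched_around node_inj cC xC.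
by case: (vertex_cases node_inj cx vy) => ->;
  rewrite ?coherent_node ?crosses_node // ?nn4 ?t0 ?t1 ?t2 ?t3; case: (coherent x).
Qed.

(** * Reduced projections *)

Hypothesis hred : reduced P.

Lemma reduced_corners x : crosses P x -> ~~ fconnect (face P) (n (n x)) x.
Proof.
by move=> cx; apply/negP => xx; apply: hred; apply/(reducibleP node_inj); exists x.
Qed.

Lemma interlaced_across y z u1 u2 : crosses P y -> crosses P z ->
    vertex P z != vertex P y -> orbit t y = y :: u1 ++ other y :: u2 ->
    z \in u1 -> other z \in u2 ->
  interlaced (vertex P y) (vertex P z).
Proof.
move=> cy cz zy rE zu1 ozu2; set w := [:: vertex P y; vertex P z; vertex P y; vertex P z].
have yz : same y z by rewrite fconnect_orbit rE inE mem_cat zu1 orbT.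
have : perm_eq [seq v <- orbit t y | vertex P v \in w] [:: y; other y; z; other z].
  apply: (@passages_perm y w [:: y; z]).
  - by rewrite /corners /= cy cz inE eq_sym zy.
  - by move=> v; rewrite !inE; case: (v == vertex P y); case: (v == vertex P z).
  by move=> v; rewrite !inE => /orP [] /eqP ->; rewrite ?connect0.
have zf : z \in [seq v <- u1 | vertex P v \in w].
  by rewrite mem_filter zu1 !inE eqxx orbT.
have ozf : other z \in [seq v <- u2 | vertex P v \in w].
  by rewrite mem_filter ozu2 vertex_other !inE eqxx orbT.
move=> /perm_size sizer; exists y; rewrite met_filter -/w; move: sizer.
rewrite rE /= filter_cat /= vertex_other mem_head /= size_cat /=.
case: [seq v <- u1 | _] zf => [|z1 [|z2 r1]] // zf;
case: [seq v <- u2 | _] ozf => [|z3 [|z4 r2]] // ozf; try by rewrite /= ?addnS.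
move=> _; move: zf ozf; rewrite !inE => /eqP <- /eqP <- /=.
by rewrite !vertex_other.
Qed.

(** The darts of the loop starting at [y] and ending at the next passage through
    the same double point.  The set is closed under [edge], so both directions of
    each edge of the loop are in it.  The last edge of the loop arrives opposite to
    [other y]. *)
Lemma loop_side y u1 u2 : crosses P y -> orbit t y = y :: u1 ++ other y :: u2 ->
  exists s : D -> bool,
    [/\ forall w, s (e w) = s w,
        forall w, vertex P w != vertex P y -> s (opposite P w) = s w,
        forall w, same y w -> s w = (w \in y :: u1),
        s (opposite P y) = false & s (opposite P (other y))].
Proof.
move=> cy rE; have sameE w : same y w = (w \in y :: u1 ++ other y :: u2).
  by rewrite fconnect_orbit rE.
have := orbit_uniq t y; have := cycle_orbit injt y; rewrite rE => cyc /= /andP [yr ur].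
have path1 : fpath t y (rcons u1 (other y)).
  move: cyc; rewrite /= rcons_cat cat_path /= => /and3P [yu1 uo _].
  by rewrite rcons_path yu1.
have u1_same w : w \in y :: u1 -> same y w.
  by rewrite sameE !inE mem_cat => /orP [] ->; rewrite ?orbT.
pose s z := (z \in y :: u1) || (e z \in y :: u1).
have s_out w : same y w -> s w = (w \in y :: u1).
  move=> yw; rewrite /s; case: (boolP (e w \in _)) => [/u1_same|_]; last exact: orbF.
  by rewrite same_edge // yw.
have s_in w : same y w -> s (opposite P w) = (w \in rcons u1 (other y)).
  move=> yw; have yow : same y (opposite P w) = false by rewrite same_opposite // yw.
  have -> : rcons u1 (other y) = [seq t z | z <- y :: u1].
    by rewrite -(belast_rcons y u1 (other y)) -fpath_map.
  have wE : t (e (opposite P w)) = w by rewrite /travel edgeK oppositeK.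
  rewrite -[in RHS]wE mem_map // /s.
  by case: (boolP (opposite P w \in y :: u1)) => [/u1_same|_] //; rewrite yow.
exists s; split=> // [w|w||]; first by rewrite /s edgeK orbC.
- wlog yw : w / same y w => [Hw|] wp.
    have [yw|yw] := boolP (same y w); first exact: Hw.
    rewrite -{2}(oppositeK node_inj node24 w) [RHS]Hw ?vertex_opposite //.
    by rewrite same_opposite.
  rewrite s_in // s_out // mem_rcons !inE.
  have [wy|_] := eqVneq w y; first by rewrite wy eqxx in wp.
  by have [wy|_] := eqVneq w (other y); first by rewrite wy vertex_other eqxx in wp.
- rewrite s_in ?connect0 // mem_rcons inE eq_sym (negPf (other_neq cy)) /=.
  by apply: contraNF yr; rewrite mem_cat => ->.
by rewrite s_in ?same_other // mem_rcons mem_head.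
Qed.

(** Suppose that nothing is interlaced with the double point of [y].  A double
    point on the loop based there is then passed twice by the loop, or not at all,
    so membership in the loop changes only around the base point, at two opposite
    corners.  By [face_parity] these lie in the same face, and the base point is
    nugatory. *)
Lemma exists_interlaced y : crosses P y -> exists q,
  [/\ q \in double_points P, vertex P y != q & interlaced (vertex P y) q].
Proof.
move=> cy; set p := vertex P y; have [u1 [u2 rE]] := orbit_other cy.
have [z /and4P [cz zp zu1 ozu2]|noz] :=
    pickP [pred z | [&& crosses P z, vertex P z != p, z \in u1 & other z \in u2]].
  exists (vertex P z); rewrite eq_sym vertex_double_point //; split=> //.
  exact: interlaced_across rE zu1 ozu2.
have [s [se s_opp s_out s3 s4]] := loop_side cy rE.
have sameE w : same y w = (w \in y :: u1 ++ other y :: u2).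
  by rewrite fconnect_orbit rE.
have s_other w : crosses P w -> same y w -> vertex P w != p -> s (other w) = s w.
  have sub a : crosses P a -> same y a -> vertex P a != p -> s a -> s (other a).
    move=> ca ya ap; have yoa : same y (other a).
      by apply: connect_trans ya _; apply: same_other.
    have neq_p b : vertex P b = vertex P a -> (b != y) && (b != other y).
      move=> vb; apply/andP; split; apply: contraNneq ap => by_; rewrite -vb by_ //.
      by rewrite vertex_other.
    have /andP [ay _] := neq_p a erefl.
    have /andP [oay oaoy] := neq_p _ (vertex_other a).
    rewrite !s_out // !inE (negPf ay) (negPf oay) /= => au1.
    have := noz a; rewrite /= ca ap au1 /= => oau2.
    by move: yoa; rewrite sameE inE mem_cat inE (negPf oay) (negPf oaoy) oau2 !orbF.
  move=> cw yw wp; apply/idP/idP; last exact: sub.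
  move/sub; rewrite otherK // vertex_other //; apply=> //.
    by rewrite (vertex_crosses node_inj (vertex_other w)).
  by apply: connect_trans yw _; apply: same_other.
have s_node w : vertex P w != p -> s (n w) = s w.
  wlog yw : w / same y w => [Hw|] wp.
    have [yw|yw] := boolP (same y w); first exact: Hw.
    have [cw|cw] := boolP (crosses P w); last first.
      by rewrite -[RHS]s_opp // /opposite (negPf cw).
    rewrite -[RHS]s_opp // -[RHS]Hw ?vertex_opposite ?same_opposite //.
    by rewrite -[LHS]s_opp ?vertex_node // /opposite crosses_node // cw.
  have [cw|cw] := boolP (crosses P w); last first.
    by rewrite -[RHS]s_opp // /opposite (negPf cw).
  rewrite -[RHS]s_other //; rewrite /other; case: ifPn => // _.
  rewrite finv_node // -[RHS]s_opp ?vertex_node // /opposite !crosses_node // cw.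
  by rewrite (node4 node_inj cw).
have nn4 := node4 node_inj cy.
have co : crosses P (other y) by rewrite (vertex_crosses node_inj (vertex_other y)).
have s1 : s y by rewrite s_out ?connect0 // mem_head.
have s2 : s (other y) = false.
  rewrite s_out ?same_other // inE (negPf (other_neq cy)) /=.
  have := orbit_uniq t y; rewrite rE /= cat_uniq => /and4P [_ _ oyu1 _].
  by apply: contraNF oyu1 => oyu1; rewrite /= oyu1.
(* s jumps twice around p, at a corner and at the opposite one, because s holds
   for the departure y and the arrival opposite to [other y] and fails for the
   two remaining darts. *)
have [x [vx sx [snnx snnnx]]] : exists x, [/\ vertex P x = p, s (n x) != s x
    & s (n (n x)) = s (n x) /\ s (n (n (n x))) = s x].
  move: s2 s3 s4; rewrite /opposite co cy /other; case: ifPn => _.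
    by exists y; rewrite s1 s2 s3 s4.
  rewrite finv_node // nn4 => s2 s3 s4.
  by exists (n y); rewrite vertex_node // nn4 s1 s2 s3 s4.
have cx : crosses P x by rewrite (vertex_crosses node_inj vx).
have [w [xw sw sw']] := face_parity edgeK node_inj se sx.
have vw : vertex P w = vertex P x.
  by rewrite vx; apply: contraTeq sw => /s_node ->; rewrite eqxx.
case: (vertex_cases node_inj cx vw) => wE.
- by rewrite wE eqxx in sw'.
- by rewrite wE snnx eqxx in sw.
- have := @reduced_corners (n (n x)); rewrite !crosses_node //.
  by rewrite (node4 node_inj cx) -wE xw => /(_ cx).
by rewrite wE (node4 node_inj cx) snnnx eqxx in sw.
Qed.

Lemma not_reducible_by_zero : ~ made_reducible_by P 0.
Proof.
case=> S [subS /eqP]; rewrite cards_eq0 => /eqP -> [_ [injQ _] _ _ _].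
case/(reducibleP injQ) => x; set Q := seifert_splice P set0.
have nodeE : node Q =1 n by move=> y; rewrite /= inE.
have faceE : face Q =1 face P by apply: eq_face.
rewrite !nodeE (eq_fconnect faceE) => cQ xx.
have cx : crosses P x.
  by move: cQ; rewrite /crosses /order (eq_card (eq_fconnect nodeE x)).
by have := reduced_corners cx; rewrite xx.
Qed.

(** Neither zero nor one splice makes a reduced projection reducible. *)
Lemma has_reductivity2 : has_reductivity P 2 <-> made_reducible_by P 2.
Proof.
split=> [[] //|made2]; split=> // [[|[|j]]] //; first by move/not_reducible_by_zero.
by move/(not_reducible_by_one).
Qed.

Lemma coherent_opposite_ends s C x y z : corners P C -> sided P s C -> x \in C ->
    vertex P y = vertex P x -> vertex P z = vertex P x -> same y z -> y != z ->
  coherent x = (s y != s z).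
Proof.
move=> cC sC xC vy vz yz nyz.
have cy : crosses P y.
  by rewrite (vertex_crosses node_inj vy) (corners_crosses cC xC).
rewrite -(sided_other cC sC xC vy) eq_sym.
have zy : z != y by rewrite eq_sym.
by rewrite -(other_unique cy _ yz zy) // vz.
Qed.

Lemma admissible_sided C k : admissible P C -> #|meeting_points P C| = k.+1 -> k < 3 ->
  corners P C /\ exists s, sided P s C.
Proof.
move=> [aC uC jC _] sizeC k3; have cC : corners P C by rewrite /corners aC.
rewrite size_corners // in sizeC; split=> //.
apply: exists_sided reduced_corners _ conP sphP _ cC jC _ => //.
  by rewrite -size_eq0 sizeC.
by rewrite sizeC.
Qed.

Lemma cycle_from C z : z \in C -> corners P C -> cycle (joined P) C -> exists L,
  cycle (joined P) (z :: L) /\ {subset L <= [predD1 C & z]}.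
Proof.
move=> zC cC jC; have [i L rotE] := rot_to zC; exists L.
have uC := corners_uniq cC; rewrite -rotE rot_cycle; split=> // x xL.
have : uniq (z :: L) by rewrite -rotE rot_uniq.
rewrite !inE -(mem_rot i) rotE inE xL orbT andbT /= => /andP [zL _].
by apply: contraNneq zL => <-.
Qed.

Lemma met_passages (w : seq {set D}) : met_in_cyclic_order P w -> exists x,
  let r := [seq y <- orbit t x | vertex P y \in w] in
  [/\ [seq vertex P y | y <- r] = w, uniq r & {in r &, forall y z, same y z}].
Proof.
case=> x; rewrite met_filter => rw; exists x; split=> //.
  by rewrite filter_uniq.
move=> y z; rewrite !mem_passages => /andP [_ xy] /andP [_ xz].
by apply: connect_trans xz; rewrite fconnect_sym.
Qed.

Lemma meeting_corner C v :
  v \in meeting_points P C -> exists2 x, x \in C & vertex P x = v.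
Proof. by case/imsetP=> x; exists x. Qed.

(** * From a curve to a splice *)

(** The points [a] and [b] are not interlaced, so [a] is spliced together with
    an auxiliary point [q] that [C] avoids. *)
Lemma splice_of_abba C a b : admissible P C -> uniq [:: a; b] ->
    meeting_points P C = [set a; b] -> met_in_cyclic_order P [:: a; b; b; a] ->
  made_reducible_by P 2.
Proof.
move=> aC; rewrite /= inE andbT => ab CE.
have [|//|cC [s sC]] := admissible_sided (k := 1) aC; first by rewrite CE cards2 ab.
have [_ _ jC _] := aC.
have wC w : w =i [:: a; b] -> w =i meeting_points P C.
  by move=> wE v; rewrite wE CE !inE.
have wE1 : [:: a; b; b; a] =i meeting_points P C.
  by apply: wC => v; rewrite !inE; case: (v == a); case: (v == b).
case/met_passages => x /=; set r := filter _ _ => -[rw ur rr].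
have := passages_alternate x cC sC wE1.
rewrite -/r; move: rw ur rr; case: r => [|y1 [|y2 [|y3 [|y4 []]]]] //=.
case=> v1 v2 v3 v4; rewrite !inE !negb_or => /and4P [/and3P [_ _ n14] /andP [n23 _] _ _].
move=> rr /and5P [/eqP s2 /eqP s3 /eqP s4 /eqP s1 _].
have [xa xaC va] : exists2 xa, xa \in C & vertex P xa = a.
  by apply: meeting_corner; rewrite CE set21.
have [xb xbC vb] : exists2 xb, xb \in C & vertex P xb = b.
  by apply: meeting_corner; rewrite CE set22.
have cxa := corners_crosses cC xaC; have cxb := corners_crosses cC xbC.
have coha : coherent xa.
  rewrite (coherent_opposite_ends (y := y1) (z := y4) cC sC xaC) ?va //.
    by rewrite s4 s3 s2 !negbK; case: (s y1).
  by apply: rr; rewrite !inE eqxx ?orbT.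
have [q [dq aq iaq]] := exists_interlaced cxa.
rewrite va in aq iaq.
(* [C] crosses [a] coherently, which the alternating word abab would not allow. *)
have qb : q != b.
  apply/eqP => qb; rewrite qb in iaq.
  have wE2 : [:: a; b; a; b] =i meeting_points P C.
    by apply: wC => v; rewrite !inE; case: (v == a); case: (v == b).
  case: (met_passages iaq) => x' /=; set r := filter _ _ => -[rw ur rr'].
  have := passages_alternate x' cC sC wE2.
  rewrite -/r; move: rw ur rr'; case: r => [|z1 [|z2 [|z3 [|z4 []]]]] //=.
  case=> w1 w2 w3 w4; rewrite !inE !negb_or => /and4P [/and3P [_ n13 _] _ _ _].
  move=> rr' /and5P [/eqP s2' /eqP s3' _ _ _].
  have := coherent_opposite_ends (y := z1) (z := z3) cC sC xaC.
  rewrite va w1 w3 coha s3' s2' negbK eqxx => /(_ erefl erefl) H.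
  by have := H (rr' _ _ _ _) n13; rewrite !inE !eqxx ?orbT => /(_ isT isT).
have [xq [vq cxq cohq]] : exists xq, [/\ vertex P xq = q, crosses P xq & coherent xq].
  have /double_pointsP [y cy ->] := dq.
  exact: exists_coherent.
have [L [jL LC]] := cycle_from xbC cC jC.
have KS : [seq vertex P x | x <- [:: xa; xq]] =i [set a; q].
  by move=> v; rewrite /= va vq !inE.
apply: (splice_reducible _ dq aq iaq
  (K := [:: xa; xq]) (z := xb) (L := L)) => //.
- by rewrite -va vertex_double_point.
- by rewrite /corners /= cxa cxq inE va vq aq.
- by move=> z; rewrite !inE => /orP [] /eqP ->.
- by rewrite vb !inE negb_or eq_sym ab eq_sym.
move=> z /LC; rewrite !inE => /andP [zb zC].
have : vertex P z \in [set a; b] by rewrite -CE; apply: imset_f.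
rewrite !inE => /orP [] /eqP vz.
  by rewrite (corners_inj cC zC xaC _) ?eqxx // va.
by rewrite (corners_inj cC zC xbC) ?eqxx ?vb // in zb.
Qed.

Lemma splice_of_abxabx C a b c : admissible P C -> uniq [:: a; b; c] ->
    meeting_points P C = [set a; b; c] ->
    met_in_cyclic_order P [:: a; b; c; a; b; c] ->
  made_reducible_by P 2.
Proof.
move=> aC uabc CE met; have := uabc; rewrite /= !inE negb_or andbT.
case/andP=> /andP [ab ac] bc.
have [|//|cC [s sC]] := admissible_sided (k := 2) aC.
  by rewrite CE setUC cardsU1 cards2 !inE negb_or ab eq_sym ac eq_sym bc.
have [_ _ jC _] := aC.
have wE : [:: a; b; c; a; b; c] =i meeting_points P C.
  by move=> v; rewrite CE !inE; case: (v == a); case: (v == b); case: (v == c).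
have iab : interlaced a b.
  case: met => x rw; exists x.
  have sub v : (v \in [:: a; b; a; b]) =
      (v \in [:: a; b; a; b]) && (v \in [:: a; b; c; a; b; c]).
    by rewrite !inE; case: (v == a); case: (v == b); rewrite ?orbT ?andbF.
  rewrite (eq_filter sub) filter_predI rw /= !inE !eqxx !(eq_sym c) (negPf ac) (negPf bc).
  by rewrite !orbT.
have [xa xaC va] : exists2 xa, xa \in C & vertex P xa = a.
  by apply: meeting_corner; rewrite -wE !inE eqxx ?orbT.
have [xb xbC vb] : exists2 xb, xb \in C & vertex P xb = b.
  by apply: meeting_corner; rewrite -wE !inE eqxx ?orbT.
have [xc xcC vc] : exists2 xc, xc \in C & vertex P xc = c.
  by apply: meeting_corner; rewrite -wE !inE eqxx ?orbT.
have cxa := corners_crosses cC xaC; have cxb := corners_crosses cC xbC.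
have cxc := corners_crosses cC xcC.
case: (met_passages met) => x /=; set r := filter _ _ => -[rw ur rr].
have := passages_alternate x cC sC wE.
rewrite -/r; move: rw ur rr; case: r => [|y1 [|y2 [|y3 [|y4 [|y5 [|y6 []]]]]]] //=.
case=> v1 v2 v3 v4 v5 v6; rewrite !inE !negb_or.
case/and5P=> /and5P [_ _ n14 _ _] /and4P [_ _ n25 _] _ _ _.
move=> rr /and5P [/eqP s2 /eqP s3 /eqP s4 /eqP s5 _].
have coha : coherent xa.
  rewrite (coherent_opposite_ends (y := y1) (z := y4) cC sC xaC) ?va //.
    by rewrite s4 s3 s2 !negbK; case: (s y1).
  by apply: rr; rewrite !inE eqxx ?orbT.
have cohb : coherent xb.
  rewrite (coherent_opposite_ends (y := y2) (z := y5) cC sC xbC) ?vb //.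
    by rewrite s5 s4 s3 !negbK; case: (s y2).
  by apply: rr; rewrite !inE eqxx ?orbT.
have [L [jL LC]] := cycle_from xcC cC jC.
have KS : [seq vertex P x | x <- [:: xa; xb]] =i [set a; b].
  by move=> v; rewrite /= va vb !inE.
apply: (splice_reducible _ _ ab iab
  (K := [:: xa; xb]) (z := xc) (L := L)) => //.
- by rewrite -va vertex_double_point.
- by rewrite -vb vertex_double_point.
- by rewrite /corners /= cxa cxb inE va vb ab.
- by move=> z; rewrite !inE => /orP [] /eqP ->.
- by rewrite vc !inE negb_or eq_sym ac eq_sym.
move=> z /LC; rewrite !inE => /andP [zc zC].
have : vertex P z \in [set a; b; c] by rewrite -CE; apply: imset_f.
rewrite !inE -orbA => /or3P [] /eqP vz.
- by rewrite (corners_inj cC zC xaC _) ?eqxx // va.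
- by rewrite (corners_inj cC zC xbC _) ?eqxx ?orbT // vb.
by rewrite (corners_inj cC zC xcC) ?eqxx ?vc // in zc.
Qed.

(** * From a splice to a curve *)

(** In each face there are as many corners of [Z] as corners opposite to a
    corner of [Z]: the corners of [Z] are those where [s] changes from true to
    false, the opposite ones those where it changes back. *)
Lemma balanced_roots s Z : corners P Z -> sided P s Z -> {in Z, forall x, s x} ->
  perm_eq [seq froot (face P) x | x <- Z] [seq froot (face P) (n (n x)) | x <- Z].
Proof.
move=> cZ [se sn] sZ; have symf := fconnect_sym injf; have uZ := corners_uniq cZ.
have nnZ x : x \in Z -> s (n (n x)) = false /\ s (n (n (n x))).
  move=> xZ; have [t0 t1 t2 _] := touched_around node_inj cZ xZ.
  have := sn x; have := sn (n x); have := sn (n (n x)); rewrite t0 t1 t2 (sZ x xZ).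
  by case: (s (n x)); case: (s (n (n x))); case: (s (n (n (n x)))).
apply/seq.permP => a; rewrite !count_map.
(* A property of the root of the face selects a set of faces. *)
pose A : pred D := fun v => a (froot (face P) v).
have Af v : A (face P v) = A v.
  by rewrite /A; congr a; apply/esym/(rootP symf)/fconnect1.
have := face_balance edgeK node_inj se Af.
have -> : #|[pred v | [&& A v, s v & ~~ s (n v)]]| = count A Z.
  rewrite -size_filter -(card_uniqP (filter_uniq A uZ)); apply: eq_card => v.
  rewrite inE mem_filter; congr (_ && _).
  apply/andP/idP => [[sv snv]|vZ]; last first.
    by have := sn v; rewrite /touched vZ (sZ v vZ); case: (s (n v)).
  have /orP [//|vZ] : touched P Z v by rewrite -sn sv; case: (s (n v)) snv.
  have cv := corners_crosses_opposite node_inj cZ vZ.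
  by have [] := nnZ _ vZ; rewrite (node4 node_inj cv) sv.
have -> : #|[pred v | [&& A v, ~~ s v & s (n v)]]|
    = count (fun x => A (n (n x))) Z.
  rewrite -[RHS](count_map (fun x => n (n x)) A) -size_filter.
  have unn : uniq [seq n (n x) | x <- Z].
    by rewrite map_inj_uniq // => u v /node_inj /node_inj.
  rewrite -(card_uniqP (filter_uniq A unn)); apply: eq_card => v.
  rewrite inE mem_filter; congr (_ && _).
  apply/andP/mapP => [[sv snv]|[x xZ ->]]; last by have [-> ->] := nnZ x xZ.
  have /orP [vZ|vZ] : touched P Z v by rewrite -sn (negPf sv) snv.
    by rewrite (sZ v vZ) in sv.
  exists (n (n v)) => //.
  by rewrite (node4 node_inj (corners_crosses_opposite node_inj cZ vZ)).
by [].
Qed.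

(** Matching each exit corner with an entrance corner in the same face permutes
    [Z].  Reducedness forbids fixed points, and a permutation of at most three
    elements without fixed point is a single cycle. *)
Lemma joined_arrangement Z : corners P Z -> 0 < size Z <= 3 ->
    perm_eq [seq froot (face P) x | x <- Z] [seq froot (face P) (n (n x)) | x <- Z] ->
  exists2 C, perm_eq C Z & cycle (joined P) C.
Proof.
move=> cZ sizeZ; have symf := fconnect_sym injf.
have joinedE x y : joined P x y = (froot (face P) (n (n x)) == froot (face P) y).
  by rewrite /joined root_connect.
have moved x : x \in Z -> froot (face P) (n (n x)) != froot (face P) x.
  move=> xZ; rewrite root_connect //; exact: reduced_corners (corners_crosses cZ xZ).
case: Z sizeZ {cZ} moved => [|a [|b [|c [|d Z]]]] //= _ moved.
- move/perm_mem/(_ (froot (face P) a)); rewrite !inE eqxx eq_sym.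
  by rewrite (negPf (moved a _)) ?mem_head.
- move/derangement2; rewrite !moved ?inE ?eqxx ?orbT // => /(_ isT isT) [ab ba].
  by exists [:: a; b] => //=; rewrite !joinedE ab ba !eqxx.
move/derangement3; rewrite !moved ?inE ?eqxx ?orbT // => /(_ isT isT isT).
case=> -[e1 e2 e3]; first by exists [:: a; b; c] => //=; rewrite !joinedE e1 e2 e3 !eqxx.
exists [:: a; c; b]; last by rewrite /= !joinedE e1 e2 e3 !eqxx.
by rewrite perm_cons -[[:: b; c]]/(rcons [:: b] c) perm_sym perm_rcons.
Qed.

Lemma corners_filter (a : pred D) C : corners P C -> corners P [seq x <- C | a x].
Proof.
case/andP=> /allP aC uC; apply/andP; split.
  by apply/allP => x; rewrite mem_filter => /andP [_ /aC].
exact: subseq_uniq (map_subseq _ (filter_subseq _ _)) uC.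
Qed.

(** A point can be entered by either of two opposite corners; entering always by
    the one where [s] is true amounts to orienting the curve consistently. *)
Lemma upward_corners s C : corners P C -> sided P s C -> exists Z,
  [/\ corners P Z, sided P s Z, {in Z, forall x, s x}
    & [seq vertex P x | x <- Z] = [seq vertex P x | x <- C]].
Proof.
move=> cC [se sn]; pose up x := if s x then x else n (n x).
have v_up x : vertex P (up x) = vertex P x.
  by rewrite /up; case: ifP; rewrite ?vertex_node.
have vE : [seq vertex P x | x <- [seq up x | x <- C]] = [seq vertex P x | x <- C].
  by rewrite -map_comp; apply: eq_map.
have cZ : corners P [seq up x | x <- C].
  have /andP [aC uC] := cC; rewrite /corners vE uC andbT all_map.
  by apply: sub_all aC => x cx /=; rewrite (vertex_crosses node_inj (v_up x)).
exists [seq up x | x <- C]; split=> //.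
  split=> // y; rewrite sn.
  have [/mapP [x xC vy]|yC] := boolP (vertex P y \in [seq vertex P x | x <- C]).
    rewrite (touched_corner node_inj cC xC vy).
    rewrite (touched_corner node_inj cZ (map_f up xC)) ?v_up // /up.
    case: ifP => // _; rewrite (node4 node_inj (corners_crosses cC xC)).
    exact: orbC.
  have no K : [seq vertex P x | x <- K] = [seq vertex P x | x <- C] ->
      touched P K y = false.
    by move=> KE; apply: contraNF yC => /(touched_vertex node_inj); rewrite KE.
  by rewrite !no.
move=> _ /mapP [x xC ->]; rewrite /up; case: ifPn => // sx.
have [t0 t1 _ _] := touched_around node_inj cC xC.
have := sn x; have := sn (n x); rewrite t0 t1 (negPf sx).
by case: (s (n x)); case: (s (n (n x))).
Qed.

Lemma same_direction y x : crosses P x ->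
  exists d, [/\ vertex P d = vertex P x, crosses P d & same y d].
Proof.
move=> cx; case yx: (same y x); first by exists x.
exists (opposite P x); rewrite vertex_opposite // crosses_opposite //.
by rewrite same_opposite // yx.
Qed.

(** Alternation leaves the words ppcc and pccp, and the former becomes the
    latter when read from its second letter. *)
Lemma meet_abba s C y c : corners P C -> sided P s C ->
    meeting_points P C = [set vertex P y; c] -> vertex P y != c -> crosses P y ->
    s (other y) != s y ->
  met_in_cyclic_order P [:: vertex P y; c; c; vertex P y].
Proof.
set p := vertex P y; move=> cC sC CE pc cy soy.
have [xc xcC vc] : exists2 x, x \in C & vertex P x = c.
  by apply: meeting_corner; rewrite CE set22.
have [d [vd cd yd]] := same_direction y (corners_crosses cC xcC).
rewrite vc in vd.
set w := [:: p; c; c; p].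
have wE : w =i meeting_points P C.
  by move=> v; rewrite CE !inE; case: (v == p); case: (v == c).
have permr : perm_eq [seq z <- orbit t y | vertex P z \in w] [:: y; other y; d; other d].
  apply: (@passages_perm y w [:: y; d]).
  - by rewrite /corners /= cy cd inE vd pc.
  - by move=> v; rewrite wE CE /= vd !inE.
  by move=> z; rewrite !inE => /orP [] /eqP ->.
have alt := passages_alternate y cC sC wE.
have [r rE] : exists r, [seq z <- orbit t y | vertex P z \in w] = y :: r.
  by apply: head_filter_orbit; rewrite inE eqxx.
pose code z := (index (vertex P z) [:: p; c], s z).
have cp : (c == p) = false by rewrite eq_sym (negPf pc).
have u4 : perm_eq [seq code z | z <- y :: r]
    [:: (0, s y); (0, ~~ s y); (1, s d); (1, s (other d))].
  rewrite -rE; apply: perm_trans (perm_map code permr) _.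
  have -> : ~~ s y = s (other y) by move: soy; case: (s y); case: (s (other y)).
  by rewrite /code /= !vertex_other // vd -/p eqxx (negPf pc) eqxx.
have altu : cycle (fun i j : nat * bool => j.2 == ~~ i.2) [seq code z | z <- y :: r].
  by rewrite cycle_map -rE.
have hdu : (head (1, true) [seq code z | z <- y :: r]).1 = 0 by rewrite /= -/p eqxx.
have vE : [seq vertex P z | z <- y :: r]
    = [seq nth set0 [:: p; c] i | i <- [seq i.1 | i <- [seq code z | z <- y :: r]]].
  rewrite -!map_comp; apply/eq_in_map => z; rewrite -rE mem_filter /= => /andP [zw _].
  by rewrite nth_index //; move: zw; rewrite !inE; case: (_ == p); case: (_ == c).
have := alternating_word4 u4 altu hdu; move: vE; set u := [seq i.1 | i <- _].
rewrite !inE => vE /orP [] /eqP uE; rewrite {}uE in vE.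
  by exists y; rewrite met_filter rE vE.
have [x xE] := filter_rot1 rE.
by exists x; rewrite met_filter xE map_rcons; case: vE => ->.
Qed.

(** Among the six passages, alternation puts the two through [p], and the two
    through [q], at odd distance; distance one is excluded by
    [passages_no_return], which leaves distance three. *)
Lemma meet_abcabc s S C y1 y2 c : corners P C -> sided P s C ->
    S \subset double_points P -> single_curve (seifert_splice P S) ->
    S = [set vertex P y1; vertex P y2] ->
    meeting_points P C = [set vertex P y1; vertex P y2; c] ->
    uniq [:: vertex P y1; vertex P y2; c] ->
    s (other y1) != s y1 -> s (other y2) != s y2 ->
  let p := vertex P y1 in let q := vertex P y2 in
  met_in_cyclic_order P [:: p; q; c; p; q; c] \/
  met_in_cyclic_order P [:: p; c; q; p; c; q].
Proof.
move=> cC sC subS conQ SE CE upqc so1 so2 p q.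
have [pq pc qc] : [/\ p != q, p != c & q != c].
  by move: upqc; rewrite /= !inE negb_or andbT => /andP [/andP []].
have cross := spliced_crosses subS.
have cy1 : crosses P y1 by apply: cross; rewrite SE set21.
have cy2 : crosses P y2 by apply: cross; rewrite SE set22.
have [xc xcC vc] : exists2 x, x \in C & vertex P x = c.
  by apply: meeting_corner; rewrite CE !inE eqxx orbT.
have [d [vd cd yd]] := same_direction y1 (corners_crosses cC xcC).
rewrite vc in vd.
have [d2 [vd2 cd2 yd2]] := same_direction y1 cy2.
set w := [:: p; q; c].
have wE : w =i meeting_points P C by move=> v; rewrite CE !inE orbA.
have permr : perm_eq [seq z <- orbit t y1 | vertex P z \in w]
    [:: y1; other y1; d2; other d2; d; other d].
  apply: (@passages_perm y1 w [:: y1; d2; d]).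
  - by rewrite /corners /= cy1 cd2 cd !inE vd vd2 -/p -/q negb_or pq pc qc.
  - by move=> v; rewrite wE CE /= vd vd2 !inE orbA.
  by move=> z; rewrite !inE => /or3P [] /eqP ->.
have alt := passages_alternate y1 cC sC wE.
have Sw : {subset S <= w}.
  by move=> v; rewrite SE !inE => /orP [] ->; rewrite ?orbT.
have nor := passages_no_return y1 subS Sw conQ.
have [r rE] : exists r, [seq z <- orbit t y1 | vertex P z \in w] = y1 :: r.
  by apply: head_filter_orbit; rewrite inE eqxx.
pose idx v := index v w; pose code z := (idx (vertex P z), s z).
have [iE1 iE2 iE3] : [/\ idx p = 0, idx q = 1 & idx c = 2].
  by rewrite /idx /= !eqxx (negPf pq) (negPf pc) (negPf qc).
have so_d2 : s (other d2) = ~~ s d2.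
  have [xq xqC vq] : exists2 x, x \in C & vertex P x = q.
    by apply: meeting_corner; rewrite CE !inE eqxx orbT.
  have so z : vertex P z = q -> (s (other z) != s z) = coherent xq.
    move=> vz; apply: (sided_other cC sC xqC).
    by rewrite vq.
  have := so d2 vd2; rewrite -(so y2) // so2.
  by case: (s d2); case: (s (other d2)).
have u6 : perm_eq [seq code z | z <- y1 :: r]
    [:: (0, s y1); (0, ~~ s y1); (1, s d2); (1, ~~ s d2); (2, s d); (2, s (other d))].
  rewrite -rE; apply: perm_trans (perm_map code permr) _.
  have -> : ~~ s y1 = s (other y1) by move: so1; case: (s y1); case: (s (other y1)).
  by rewrite -so_d2 /code [map _ _]/= !vertex_other // vd vd2 -/p -/q iE1 iE2 iE3.
have altu : cycle (fun i j : nat * bool => j.2 == ~~ i.2) [seq code z | z <- y1 :: r].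
  by rewrite cycle_map -rE.
have noru : cycle (fun i j : nat * bool => (i.1 == j.1) && (i.1 < 2) ==> (i == j))
    [seq code z | z <- y1 :: r].
  rewrite cycle_map -rE; apply: (sub_in_cycle (P := [pred z | vertex P z \in w])) nor.
    move=> y z /= yw zw /implyP noryz; apply/implyP => /andP [/eqP iyz iy].
    have vyz : vertex P y = vertex P z.
      by rewrite -[LHS](nth_index set0 yw) -/(idx _) iyz nth_index.
    rewrite (eqP (noryz _)) // vyz eqxx SE -vyz; move: yw iy.
    by rewrite !inE => /or3P [] /eqP ->; rewrite ?iE3 ?eqxx ?orbT.
  by apply/allP => z; rewrite mem_filter => /andP [].
have hdu : (head (1, true) [seq code z | z <- y1 :: r]).1 = 0 by rewrite /= -/p iE1.
have vE : [seq vertex P z | z <- y1 :: r]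
    = [seq nth set0 w i | i <- [seq i.1 | i <- [seq code z | z <- y1 :: r]]].
  rewrite -!map_comp; apply/eq_in_map => z; rewrite -rE mem_filter => /andP [zw _].
  by rewrite /= nth_index.
have := alternating_word6 u6 altu noru hdu; move: vE; set u := [seq i.1 | i <- _].
rewrite !inE => vE uE.
have met_w (w' : seq {set D}) : w' =i w -> [seq vertex P z | z <- y1 :: r] = w' ->
    met_in_cyclic_order P w'.
  move=> ww' vw'; exists y1; rewrite met_filter -vw' -rE; congr map.
  by apply: eq_filter => z; rewrite rE vw' ww'.
by case/orP: uE vE => /eqP -> vE; [left|right]; apply: met_w => // v;
  rewrite !inE; case: (v == p); case: (v == q); case: (v == c).
Qed.

(** [w] is the corner by which a curve meeting the splice only once enters the
    nugatory point.  The function [s] of its two sides may change, as a function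
    on [P], at [w] and at coherent corners [zp] and [zq] of the spliced points;
    the corners where it does change form the required curve. *)
Lemma curve_of_splice : made_reducible_by P 2 ->
  exists C : seq D, admissible P C /\
    ((exists a b : {set D},
        [/\ uniq [:: a; b],
            meeting_points P C = [set a; b]
          & met_in_cyclic_order P [:: a; b; b; a]]) \/
     (exists a b x : {set D},
        [/\ uniq [:: a; b; x],
            meeting_points P C = [set a; b; x]
          & met_in_cyclic_order P [:: a; b; x; a; b; x]])).
Proof.
case=> S [subS /eqP /cards2P [p [q [pq SE]]]].
set Q := seifert_splice P S; case=> [[_ _] [injQ _] conQ sphQ _].
case/(reducibleP injQ) => w cwQ ww.
have /andP [cw wS] : crosses P w && (vertex P w \notin S) by rewrite -crosses_splice.
have nQ z : vertex P z = vertex P w -> node Q z = n z.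
  by move=> vz; rewrite node_unspliced // vz.
have cQ : corners Q [:: w] by rewrite /corners /= cwQ.
have jQ : cycle (joined Q) [:: w] by rewrite /= andbT.
have edgeQ : involutive (edge Q) := edgeK.
have [s [se sub [y [z syz]]]] := jordan edgeQ edge_neq injQ sphQ (C := [:: w]) isT cQ jQ.
have touchedQ v : touched Q [:: w] v -> touched P [:: w] v.
  rewrite /touched !inE => /orP [->//|nnv].
  have vv : vertex P v = vertex P w.
    by rewrite -(eqP nnv) !vertex_node_splice.
  by move: nnv; rewrite (nQ v vv) nQ ?vertex_node // => ->; rewrite orbT.
have coherent_at v : v \in S -> exists z, [/\ vertex P z = v, crosses P z & coherent z].
  move/(subsetP subS)/double_pointsP => [x cx ->].
  exact: exists_coherent.
have [pS qS] : p \in S /\ q \in S by rewrite SE set21 set22.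
have [zp [vp cp cohp]] := coherent_at p pS; have [zq [vq cq cohq]] := coherent_at q qS.
set C0 := [:: w; zp; zq].
have cC0 : corners P C0.
  move: wS; rewrite /corners /= cw cp cq !inE vp vq SE !inE => ->.
  by rewrite pq.
have subP v : s (n v) != s v -> touched P C0 v.
  rewrite touched_cons // => sv.
  have [cohv|ncohv] := boolP ((vertex P v \in S) && coherent v); last first.
    have nE : node Q v = n v.
      have [vS|vS] := boolP (vertex P v \in S); last exact: node_unspliced.
      rewrite vS /= in ncohv.
      by rewrite node_spliced // /seifert_partner -/(coherent v) (negPf ncohv).
    have : touched Q [:: w] v by apply: sub; rewrite nE.
    move/touchedQ; rewrite touched_cons // => /or3P [->|->|] //; by rewrite ?orbT.
  case/andP: cohv => vS cohv.
  suff ends z' : coherent z' -> crosses P z' -> vertex P v = vertex P z' ->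
      (v == z') || (v == n (n z')).
    rewrite !touched_cons //; move: vS; rewrite SE !inE -vp -vq.
    case/orP=> /eqP vE.
      by case/orP: (ends _ cohp cp vE) => ->; rewrite ?orbT.
    by case/orP: (ends _ cohq cq vE) => ->; rewrite ?orbT.
  move=> cohz' cz' /esym/eqP; rewrite crosses_vertex // !inE.
  by case/or4P=> /eqP vE; rewrite vE ?eqxx ?orbT //; move: cohv;
     rewrite vE !coherent_node ?crosses_node // cohz'.
have sC1 := jumps_sided node_inj cC0 se subP.
have sw : s (n w) != s w.
  apply/negP => sw; case/negP: syz; apply/eqP.
  apply: (single_curve_const conQ se) => v; apply/eqP/negPn/negP => sv.
  have sub_w := jump_opposite injQ cQ sub (mem_head w _).
  have := sub v sv; rewrite (touched_cons injQ) // orbF => /orP [] /eqP vE.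
    by rewrite vE nQ // sw in sv.
  by rewrite vE sub_w nQ // sw in sv.
have {sw} C1E : [seq x <- C0 | s (n x) != s x]
    = w :: [seq x <- [:: zp; zq] | s (n x) != s x].
  by rewrite /= sw.
have cC1 := corners_filter (fun x => s (n x) != s x) cC0.
rewrite {}C1E in sC1 cC1; set C1 := w :: _ in sC1 cC1.
have sizeC1 : size C1 <= 3.
  rewrite -[size C1]/(size [seq x <- [:: zp; zq] | s (n x) != s x]).+1 ltnS size_filter.
  exact: (count_size _ [:: zp; zq]).
have [Z [cZ sZ upZ vZ]] := upward_corners cC1 sC1.
have sizeZ : size Z = size C1 by have := congr1 size vZ; rewrite !size_map.
have [|C permC jC] := joined_arrangement cZ _ (balanced_roots cZ sZ upZ).
  by rewrite sizeZ.
have cC : corners P C.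
  move: cZ; rewrite /corners (perm_all _ permC).
  by rewrite (perm_uniq (perm_map (vertex P) permC)).
have sC : sided P s C.
  have [_ snZ] := sZ; split=> // v; rewrite snZ /touched.
  by rewrite !(perm_mem permC).
have aC : admissible P C.
  apply: admissible_small cC jC _ => //; first exact: reduced_corners.
  by rewrite (perm_size permC) sizeZ.
have CE v : (v \in meeting_points P C) = (v \in [seq vertex P x | x <- C1]).
  by rewrite mem_meeting -vZ (perm_mem (perm_map (vertex P) permC)).
have wp : vertex P w != p by apply: contraNneq wS => ->.
have wq : vertex P w != q by apply: contraNneq wS => ->.
exists C; split=> //.
have jump x : x \in C1 -> coherent x -> s (other x) != s x.
  by move=> xC1 cohx; rewrite (sided_other cC1 sC1 xC1).
have one x : coherent x -> crosses P x -> vertex P x != vertex P w -> C1 = [:: w; x] ->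
  exists a b : {set D}, [/\ uniq [:: a; b], meeting_points P C = [set a; b]
          & met_in_cyclic_order P [:: a; b; b; a]].
  move=> cohx cx xw C1E; exists (vertex P x), (vertex P w).
  have ME : meeting_points P C = [set vertex P x; vertex P w].
    by apply/setP => v; rewrite CE C1E !inE orbC.
  split; rewrite //= ?inE ?andbT //.
  by apply: (meet_abba cC sC) => //; apply: jump; rewrite // C1E !inE eqxx orbT.
(* The curve consists of [w] and those of [zp], [zq] where [s] changes; it cannot
   be [w] alone since [P] is reduced. *)
case jp: (s (n zp) != s zp); case jq: (s (n zq) != s zq).
- have C1E : C1 = [:: w; zp; zq] by rewrite /C1 /= jp jq.
  right.
  have ME : meeting_points P C = [set vertex P zp; vertex P zq; vertex P w].
    apply/setP => v; rewrite CE C1E /= vp vq !inE.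
    by case: (v == p); case: (v == q); rewrite ?orbT ?orbF.
  have SE' : S = [set vertex P zp; vertex P zq] by rewrite vp vq.
  have upqw : uniq [:: vertex P zp; vertex P zq; vertex P w].
    by rewrite /= !inE vp vq negb_or pq !(eq_sym _ (vertex P w)) wp wq.
  have [jzp jzq] : s (other zp) != s zp /\ s (other zq) != s zq.
    by split; apply: jump; rewrite // C1E !inE eqxx ?orbT.
  case: (meet_abcabc cC sC subS conQ SE' ME upqw jzp jzq) => met.
    by exists (vertex P zp), (vertex P zq), (vertex P w).
  exists (vertex P zp), (vertex P w), (vertex P zq); split=> //.
    move: upqw; rewrite /= !inE !negb_or (eq_sym (vertex P zq)).
    by case/and3P=> /andP [-> ->] -> _.
  by rewrite ME; apply/setP => v; rewrite !inE orbAC.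
- by left; apply: (one zp); rewrite // ?vp 1?eq_sym // /C1 /= jp jq.
- by left; apply: (one zq); rewrite // ?vq 1?eq_sym // /C1 /= jp jq.
have C1E : C1 = [:: w] by rewrite /C1 /= jp jq.
have := perm_size permC; rewrite sizeZ C1E /=.
move: cC jC; case: (C) => [|x [|]] //= cx xx _.
have {}cx : crosses P x by move: cx; rewrite /corners /= !andbT.
by move: xx; rewrite andbT /joined (negPf (reduced_corners cx)).
Qed.

End KnotProjection.


Theorem theorem5 (D : finType) (P : diagram D)
    (hP : knot_projection P) (hred : reduced P) :
  has_reductivity P 2 <->
  exists C : seq D, admissible P C /\
    ((exists a b : {set D},
        [/\ uniq [:: a; b],
            meeting_points P C = [set a; b]
          & met_in_cyclic_order P [:: a; b; b; a]]) \/
     (exists a b x : {set D},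
        [/\ uniq [:: a; b; x],
            meeting_points P C = [set a; b; x]
          & met_in_cyclic_order P [:: a; b; x; a; b; x]])).
Proof.
rewrite has_reductivity2 //; split; first exact: curve_of_splice.
case=> C [aC [[a [b [uab CE met]]]|[a [b [c [uabc CE met]]]]]].
  exact: splice_of_abba aC uab CE met.
exact: splice_of_abxabx aC uabc CE met.
Qed.
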